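(* There exists an algorithm that, for every instance of the split scheduling problem with uniform setup times on $m=2$ identical parallel machines with $n$ jobs, computes a schedule minimising the total completion time $\sum_j C_j$ in $O(n\log n)$ time.
   Context: Split scheduling with uniform setup times: there are $m$ identical parallel machines and $n$ jobs; job $j$ has processing time $p_j\ge 0$, and there is a setup time $s>0$. Each job may be split into parts of arbitrary positive lengths summing to $p_j$, which may be processed on any machines, and parts of the same job may be processed simultaneously on different machines. Before processing a job part, the machine on which it is processed must perform a setup of length $s$; during a setup the machine cannot process or set up anything else, and each machine processes at most one thing at a time. The completion time $C_j$ of job $j$ is the time at which its last part finishes. *)

(* Defs.v *)
From HB Require Import structures.
From mathcomp Require Import all_boot all_order all_algebra.

Set Implicit Arguments.
Unset Strict Implicit.
Unset Printing Implicit Defensive.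

Import Order.TTheory GRing.Theory Num.Theory.
Local Open Scope ring_scope.

(** * Split scheduling with uniform setup times *)

(** One part of job [pjob], run on machine [pmach]: its setup occupies
    [[psetup, psetup + s]] and its processing [[pstart, pstart + plen]]. *)
Record part (R : Type) (m n : nat) := Part {
  pjob : 'I_n;
  pmach : 'I_m;
  psetup : R;
  pstart : R;
  plen : R
}.

(** The list order carries no meaning, and a job may have any number of parts
    on any number of machines. *)
Definition schedule (R : Type) (m n : nat) := seq (part R m n).

Section Scheduling.
Variables (R : realFieldType) (m n : nat).
Implicit Types (s : R) (p : 'I_n -> R) (a b : part R m n) (S : schedule R m n).

Definition pend a : R := pstart a + plen a.

Definition part_ok s a : bool :=
  [&& 0 < plen a, 0 <= psetup a & psetup a + s <= pstart a].

(** The machine may idle between the setup of a part and its processing, but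
    does nothing for another part in between: a setup only serves the part that
    comes next on the machine. *)
Definition compatible a b : bool :=
  (pmach a == pmach b) ==> (pend a <= psetup b) || (pend b <= psetup a).

Definition feasible s p S : bool :=
  [&& all (part_ok s) S,
      pairwise compatible S
    & [forall j, \sum_(a <- S | pjob a == j) plen a == p j]].

(** Finishing times in a feasible schedule are positive, so the base value [0]
    only matters for a job with [p j = 0], which has no part. *)
Definition completion S (j : 'I_n) : R :=
  \big[Num.max/0]_(a <- S | pjob a == j) pend a.

Definition total_completion S : R := \sum_(j < n) completion S j.

Definition optimal s p S : Prop :=
  feasible s p S /\
  forall S', feasible s p S' -> total_completion S <= total_completion S'.

End Scheduling.

(** * Real RAM

    Programs for a random access machine with an integer memory and a real
    memory, both indexed by natural numbers and both supporting indirect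
    addressing by computed integers.  Integers can be added, subtracted
    (truncated at 0) and compared; reals can be combined by the four field
    operations and compared, and are never converted to integers.  Programs do
    not mention the real field, so the only real literals are 0 and 1. *)

Inductive iexp :=
| IConst of nat
| ILoad of iexp
| IAdd of iexp & iexp
| ISub of iexp & iexp.

Inductive rexp :=
| RZero
| ROne
| RLoad of iexp
| RAdd of rexp & rexp
| RSub of rexp & rexp
| RMul of rexp & rexp
| RDiv of rexp & rexp.

Inductive bexp :=
| ILe of iexp & iexp
| RLe of rexp & rexp.

Inductive cmd :=
| Skip
| IStore of iexp & iexp
| RStore of iexp & rexp
| Seq of cmd & cmd
| If of bexp & cmd & cmd
| While of bexp & cmd.

(** Every node of an evaluated expression costs one time unit. *)
Fixpoint icost (e : iexp) : nat :=
  match e with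
  | IConst _ => 1
  | ILoad e1 => (icost e1).+1
  | IAdd e1 e2 | ISub e1 e2 => (icost e1 + icost e2).+1
  end.

Fixpoint rcost (e : rexp) : nat :=
  match e with
  | RZero | ROne => 1
  | RLoad e1 => (icost e1).+1
  | RAdd e1 e2 | RSub e1 e2 | RMul e1 e2 | RDiv e1 e2 =>
      (rcost e1 + rcost e2).+1
  end.

Definition bcost (b : bexp) : nat :=
  match b with
  | ILe e1 e2 => (icost e1 + icost e2).+1
  | RLe e1 e2 => (rcost e1 + rcost e2).+1
  end.

Record state (R : Type) := State { imem : nat -> nat; rmem : nat -> R }.

Section Semantics.
Variable R : realFieldType.
Implicit Types (st : state R).

Fixpoint ieval st (e : iexp) : nat :=
  match e with
  | IConst k => k
  | ILoad e1 => imem st (ieval st e1)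
  | IAdd e1 e2 => ieval st e1 + ieval st e2
  | ISub e1 e2 => ieval st e1 - ieval st e2
  end%N.

Fixpoint reval st (e : rexp) : R :=
  match e with
  | RZero => 0
  | ROne => 1
  | RLoad e1 => rmem st (ieval st e1)
  | RAdd e1 e2 => reval st e1 + reval st e2
  | RSub e1 e2 => reval st e1 - reval st e2
  | RMul e1 e2 => reval st e1 * reval st e2
  | RDiv e1 e2 => reval st e1 / reval st e2
  end.

Definition beval st (b : bexp) : bool :=
  match b with
  | ILe e1 e2 => (ieval st e1 <= ieval st e2)%N
  | RLe e1 e2 => reval st e1 <= reval st e2
  end.

Definition upd (V : Type) (f : nat -> V) (k : nat) (v : V) : nat -> V :=
  fun i => if i == k then v else f i.

(** [exec c st t st']: started in [st], the program [c] halts in [st'] after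
    [t] time units. *)
Inductive exec : cmd -> state R -> nat -> state R -> Prop :=
| ExecSkip st : exec Skip st 1 st
| ExecIStore st a e :
    exec (IStore a e) st (icost a + icost e).+1
      (State (upd (imem st) (ieval st a) (ieval st e)) (rmem st))
| ExecRStore st a e :
    exec (RStore a e) st (icost a + rcost e).+1
      (State (imem st) (upd (rmem st) (ieval st a) (reval st e)))
| ExecSeq c1 c2 st st1 st2 t1 t2 :
    exec c1 st t1 st1 -> exec c2 st1 t2 st2 ->
    exec (Seq c1 c2) st (t1 + t2) st2
| ExecIf b c1 c2 st st' t :
    exec (if beval st b then c1 else c2) st t st' ->
    exec (If b c1 c2) st (bcost b + t) st'
| ExecWhileF b c st :
    ~~ beval st b -> exec (While b c) st (bcost b) st
| ExecWhileT b c st st1 st2 t1 t2 :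
    beval st b -> exec c st t1 st1 -> exec (While b c) st1 t2 st2 ->
    exec (While b c) st (bcost b + t1 + t2) st2.

Lemma exec_det c st t1 st1 t2 st2 :
  exec c st t1 st1 -> exec c st t2 st2 -> t1 = t2 /\ st1 = st2.
Proof.
move=> H; elim: H t2 st2 => {c st t1 st1}.
- by move=> st t2 st2 H; inversion H.
- by move=> st a e t2 st2 H; inversion H.
- by move=> st a e t2 st2 H; inversion H.
- move=> c1 c2 st st1 st2 t1 t2 _ IH1 _ IH2 t st' H.
  inversion H as [| | |? ? ? ? ? ? ? E1 E2| | |]; subst.
  by case: (IH1 _ _ E1) => ? ?; subst; case: (IH2 _ _ E2) => ? ?; subst.
- move=> b c1 c2 st st' t _ IH t2 st2 H.
  inversion H as [| | | |? ? ? ? ? ? E| |]; subst.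
  by case: (IH _ _ E) => ? ?; subst.
- move=> b c st nb t2 st2 H.
  inversion H as [| | | | | |? ? ? ? ? ? ? bT]; subst => //.
  by rewrite bT in nb.
- move=> b c st st1 st2 t1 t2 bT _ IH1 _ IH2 t st' H.
  inversion H as [| | | | |? ? ? nb|? ? ? ? ? ? ? _ E1 E2]; subst.
    by rewrite bT in nb.
  by case: (IH1 _ _ E1) => ? ?; subst; case: (IH2 _ _ E2) => ? ?; subst.
Qed.

(** Integer cell 0 holds the number of jobs, real cell 0 the setup time and real
    cells 1, ..., n the processing times; all other cells are 0. *)
Definition input (n : nat) (s : R) (p : 'I_n -> R) : state R :=
  State (nth 0%N [:: n]) (nth 0 (s :: [seq p j | j <- enum 'I_n])).

(** Integer cell 0 holds the number of parts; part [i] is stored in integer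
    cells [2i+1] (job), [2i+2] (machine) and in real cells [3i] (setup start),
    [3i+1] (processing start), [3i+2] (length). *)
Definition output (m n : nat) st (S : schedule R m n) : Prop :=
  [seq (nat_of_ord (pjob a), nat_of_ord (pmach a), psetup a, pstart a, plen a)
     | a <- S]
  = [seq (imem st (2 * i + 1), imem st (2 * i + 2),
          rmem st (3 * i), rmem st (3 * i + 1), rmem st (3 * i + 2))%N
     | i <- iota 0 (imem st 0)].

End Semantics.

(* Main.v *)
(** Order the jobs by completion time. When [i] jobs are complete, each machine
    has carried all their parts and setups, so the [i]-th completion time is at
    least the larger of the two loads, i.e. half of their sum plus half of
    their difference [D_i]. The sums depend only on the order and on which jobs
    are split; a whole job gives [|D_{i-1}| + |D_i| >= p_i + s]. Choosing among
    the whole jobs a set [M] of pairwise nonadjacent positions, taken greedily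
    from the end of each block of whole jobs, bounds twice the cost below by a
    sum [sum_i w_i p_i] plus a term in [s] and [M], where [w_i] is [n - i + 1],
    increased by one on [M]. These weights are nonincreasing, so the bound is
    smallest for the SPT order, and there an exchange argument replaces the
    sparse set [M] by the one that comes from keeping exactly the first [m] jobs
    whole, for some [m]. Hence it is optimal to list-schedule
    the [m] shortest jobs unsplit and to split each later one so that both
    machines finish together, for the best [m]; after a merge sort, [m] is found
    in one scan. Jobs of length 0 have no part and are discarded first. *)

Require Import Defs.
From HB Require Import structures.
From mathcomp Require Import all_boot all_order all_algebra.
From mathcomp Require Import zify ring lra.
From Stdlib Require Import FunctionalExtensionality.

Set Implicit Arguments.
Unset Strict Implicit.
Unset Printing Implicit Defensive.

Import Order.TTheory GRing.Theory Num.Theory.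
Local Open Scope ring_scope.

(** * The combinatorial lower bound *)

Section Combinatorics.
Variables (R : realFieldType) (s : R).
Hypothesis s_gt0 : 0 < s.

(** What a feasible schedule does to one job: its load (setups included) on
    each machine, its completion time, and whether it stays on one machine. *)
Record step := Step {
  steplen : R;
  stepload0 : R;
  stepload1 : R;
  stepend : R;
  stepwhole : bool
}.

(** [L0] and [L1] are the loads of the jobs that finished earlier. A whole job loads a single
    machine, so [steplen x + s] also bounds the difference of its two loads from below; a split job
    pays at least two setups. *)
Fixpoint walk (L0 L1 : R) (xs : seq step) : Prop :=
  if xs is x :: xs' then
    [/\ L0 + stepload0 x <= stepend x,
        L1 + stepload1 x <= stepend x,
        (if stepwhole x then
           (steplen x + s <= stepload0 x + stepload1 x) /\
           (steplen x + s <= `|stepload0 x - stepload1 x|)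
         else steplen x + s + s <= stepload0 x + stepload1 x)
      & walk (L0 + stepload0 x) (L1 + stepload1 x) xs']
  else True.

Lemma norm_le_both (x y : R) : x <= y -> - x <= y -> `|x| <= y.
Proof. by move=> xy nxy; rewrite ler_norml lerNl nxy. Qed.

(** The set [M] of the header: a whole job whose successor is not in [M]. *)
Fixpoint topmask (us : seq bool) : seq bool :=
  if us is u :: us' then
    let m := topmask us' in (u && ~~ head false m) :: m
  else [::].

(** The weight [k] of a job counts the jobs from it to the end, and [p + 2 * s] is the load of a
    split job. A job in [M] adds [p + s] for the imbalance it forces and subtracts [k * s] for its
    own saved setup and [(k + 1) * s] for one that its predecessor may save; in total it contributes
    [(k + 1) * p]. *)
Fixpoint relaxed (ps : seq R) (ms : seq bool) : R :=
  match ps, ms with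
  | p :: ps', m :: ms' =>
    (size ps').+1%:R * (p + 2 * s)
    + (if m then p + s - (2 * (size ps').+1%:R + 1) * s else 0)
    + relaxed ps' ms'
  | _, _ => 0
  end.

(** [relaxed] charges each job of [M] for its predecessor as well; the last
    summand undoes this for a first job. *)
Lemma walk_cost L0 L1 xs :
  let M := topmask [seq stepwhole x | x <- xs] in
  walk L0 L1 xs ->
  (size xs)%:R * (L0 + L1) + relaxed [seq steplen x | x <- xs] M
  + (if head false M then (size xs).+1%:R * s - `|L0 - L1| else 0)
  <= 2 * \sum_(x <- xs) stepend x.
Proof.
have s0 := s_gt0; elim: xs L0 L1 => [|x xs IH] L0 L1 /=; first by rewrite big_nil; lra.
case=> c0 c1 kind /IH; rewrite big_cons size_map.
set M := topmask _; set G := relaxed _ M; set C := \sum_(_ <- _) _.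
case: x c0 c1 kind => p a b c u /=.
rewrite -[(size xs).+2%:R]natr1 -[(size xs).+1%:R]natr1; set W := (size xs)%:R.
have W0 : 0 <= W by rewrite ler0n.
move=> c0 c1 kind H.
have H0 : (L0 + a) + (L1 + b) + `|L0 + a - (L1 + b)| <= 2 * c.
  have : `|L0 + a - (L1 + b)| <= 2 * c - ((L0 + a) + (L1 + b)).
    by apply: norm_le_both; lra.
  by lra.
(* If the next job is in [M], its charge already covers a setup saved here and its imbalance term
   cancels the one in [H0], so the load bound [p + s] suffices. *)
case: ifP H => hM H; rewrite ?andbF /=.
  have ab : p + s <= a + b by case: u kind => [[? _]|?]; lra.
  have := mulr_ge0 (addr_ge0 W0 ler01) (_ : 0 <= a + b - (p + s)).
  by rewrite subr_ge0 => /(_ ab); lra.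
(* A whole job is now in [M]: by the triangle inequality the imbalances before and after it add up
   to at least [p + s]. *)
case: u kind => /= [[ab dab]|ab].
  have := mulr_ge0 (addr_ge0 W0 ler01) (_ : 0 <= a + b - (p + s)).
  rewrite subr_ge0 => /(_ ab).
  have : `|a - b| <= `|L0 + a - (L1 + b)| + `|L0 - L1|.
    rewrite (_ : a - b = (L0 + a - (L1 + b)) - (L0 - L1)); last by ring.
    exact: ler_normB.
  by lra.
have := mulr_ge0 (addr_ge0 W0 ler01) (_ : 0 <= a + b - (p + s + s)).
rewrite subr_ge0 => /(_ ab).
have := normr_ge0 (L0 + a - (L1 + b)).
by lra.
Qed.

Lemma size_topmask us : size (topmask us) = size us.
Proof. by elim: us => //= u us ->. Qed.

Lemma topmask_sparse us i :
  ~~ (nth false (topmask us) i && nth false (topmask us) i.+1).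
Proof.
elim: us i => [|u us IH] [|i] //=; rewrite nth0.
by case: (head false _); rewrite ?andbF.
Qed.

(** * Reduction to the SPT order *)

Definition insert_sorted (x : R) := merge <=%R [:: x].

Lemma insert_sorted_cons x y ys : insert_sorted x (y :: ys) =
  if x <= y then x :: y :: ys else y :: insert_sorted x ys.
Proof. by []. Qed.

(** Swapping two adjacent jobs into increasing order is free whatever the mask,
    since the weight of a job is its position from the end plus its mask bit. *)
Lemma relaxed_insert x ys ms :
  size ms = (size ys).+1 ->
  relaxed (insert_sorted x ys) ms <= relaxed (x :: ys) ms.
Proof.
elim: ys ms => [|y ys IH] [|m1 [|m2 ms]] //= [sz].
rewrite -/(insert_sorted x (y :: ys)) insert_sorted_cons.
have [//|xy] := lerP x y.
apply: le_trans (_ : relaxed [:: y, x & ys] [:: m1, m2 & ms] <= _).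
  rewrite [relaxed (y :: insert_sorted x ys) _]/=.
  rewrite [relaxed [:: y, x & ys] _]/=.
  have -> : size (insert_sorted x ys) = (size ys).+1 by rewrite size_merge.
  by rewrite lerD2l; apply: IH; rewrite /= sz.
rewrite /= -[(size ys).+2%:R]natr1 -[(size ys).+1%:R]natr1; set W := (size ys)%:R.
have W0 : 0 <= W by rewrite ler0n.
(* The mask can raise the second weight [W + 1] by one, hence at most to the first weight
   [W + 2]. *)
by case: (m1) (m2) => [] []; nra.
Qed.

Definition insertion_sort := foldr insert_sorted [::].

Lemma perm_insertion_sort ps : perm_eq (insertion_sort ps) ps.
Proof.
elim: ps => //= p ps IH.
by rewrite perm_merge /= perm_cons.
Qed.

Lemma insertion_sort_sorted ps : sorted <=%R (insertion_sort ps).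
Proof.
elim: ps => //= p ps IH.
by apply: merge_sorted => //; exact: le_total.
Qed.

Lemma relaxed_sort ps ms :
  size ms = size ps -> relaxed (insertion_sort ps) ms <= relaxed ps ms.
Proof.
elim: ps ms => [|p ps IH] [|m ms] //= [sz].
have szs := perm_size (perm_insertion_sort ps).
apply: le_trans (relaxed_insert _ _) _; first by rewrite /= sz szs.
by rewrite /= szs lerD2l IH.
Qed.

(** * From a sparse set to a prefix of whole jobs *)

Definition base (ps : seq R) : R :=
  \sum_(i < size ps) (size ps - i)%:R * (ps`_i + 2 * s).

Lemma relaxedE ps ms : size ms = size ps ->
  relaxed ps ms = base ps +
  \sum_(i < size ps)
    (if nth false ms i then ps`_i + s - (2 * (size ps - i)%:R + 1) * s else 0).
Proof.
rewrite /base; elim: ps ms => [|p ps IH] [|m ms] //= => [_|[sz]].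
  by rewrite !big_ord0 addr0.
rewrite IH // !big_ord_recl /= subn0.
by rewrite addrACA.
Qed.

(** [gap] is the difference of the loads when the first [i] jobs are kept whole
    and alternate between the machines; [gain] is twice the cost of doing so,
    relative to splitting every job evenly. *)
Fixpoint gap (ps : seq R) (i : nat) : R :=
  if i is k.+1 then ps`_k + s - gap ps k else 0.

Fixpoint gain (ps : seq R) (i : nat) : R :=
  if i is k.+1 then gain ps k + gap ps k.+1 - (size ps - k)%:R * s else 0.

Lemma nth_sorted (ps : seq R) i j : sorted <=%R ps ->
  (i <= j)%N -> (j < size ps)%N -> ps`_i <= ps`_j.
Proof.
move=> srt ij js.
by apply: (sorted_leq_nth le_trans lexx) => //; rewrite inE ?(leq_ltn_trans ij).
Qed.

(** Each position of the sparse set pays for two more whole jobs at the front: from [t] to [t + 2],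
    [gain] grows by exactly the summand of position [t + 1], which in sorted order is at most that
    of any later position. If position 0 is in the set, its summand and the extra term add up to
    [gain ps 1]. *)
Lemma sparse_gain ps ms : sorted <=%R ps ->
  (forall i, ~~ (nth false ms i && nth false ms i.+1)) ->
  exists2 t, (t <= size ps)%N &
  gain ps t <=
  \sum_(i < size ps)
    (if nth false ms i then ps`_i + s - (2 * (size ps - i)%:R + 1) * s else 0)
  + (if (0 < size ps)%N && head false ms then (size ps).+1%:R * s else 0).
Proof.
move=> srt sparse; have s0 := s_gt0.
set F := fun i : nat =>
  if nth false ms i then ps`_i + s - (2 * (size ps - i)%:R + 1) * s else 0.
rewrite (eq_bigr (fun i : 'I__ => F i)) //.
set N := size ps.
(* The last clause records the room left by an unmasked last position, so that [t + 2] still fits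
   when the next position is masked. *)
suff: forall i, (i <= N)%N ->
  exists t, [/\ (t <= i)%N,
    gain ps t <= \sum_(k < i) F k +
      (if (0 < i)%N && head false ms then N.+1%:R * s else 0) &
    (0 < i)%N -> ~~ nth false ms i.-1 -> (t < i)%N].
  by move=> /(_ N (leqnn N)) [t [? ? _]]; exists t.
elim=> [|i IH] iN; first by exists 0%N; rewrite big_ord0 addr0.
have [t [ti Gt tlt]] := IH (ltnW iN).
rewrite big_ord_recr /= {2}/F.
case mi: (nth false ms i); last first.
  exists t; split => //; first exact: leqW.
  rewrite addr0; case: i mi {IH iN ti tlt} Gt => [|i] // mi.
  by rewrite -nth0 mi.
case: i mi {IH} iN ti Gt tlt => [|i] mi iN ti Gt tlt.
  exists 1%N; split=> //=.
  rewrite big_ord0 -nth0 mi subn0 -/N -[N.+1%:R]natr1 add0r subr0 add0r.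
  by lra.
have mi0 : ~~ nth false ms i by have := sparse i; rewrite mi andbT.
have {}ti : (t <= i)%N by exact: tlt.
exists t.+2; split=> //.
rewrite [gain _ _]/= -/N.
have le_p : ps`_t.+1 <= ps`_i.+1 by apply: nth_sorted.
have -> : (N - t = (N - t.+1).+1)%N by lia.
have le_w : (N - i.+1)%:R <= (N - t.+1)%:R :> R by rewrite ler_nat; lia.
rewrite -natr1; rewrite /= in Gt.
set S := \sum_(k < i.+1) _ in Gt *; set h := if _ then _ else _ in Gt *.
have := ler_wpM2r (ltW s_gt0) le_w.
by lra.
Qed.

(** With both machines empty at first, the imbalance in [walk_cost] vanishes and its correction for
    a first job in [M] is the extra term of [sparse_gain]; sorting and exchanging only lower the
    bound. *)
Lemma walk_gain xs ps : walk 0 0 xs -> sorted <=%R ps ->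
  perm_eq ps [seq steplen x | x <- xs] ->
  exists2 t, (t <= size ps)%N &
    base ps + gain ps t <= 2 * \sum_(x <- xs) stepend x.
Proof.
move=> /walk_cost /= cost srt prm; move: cost.
set us := map (@stepwhole) xs; set qs := map (@steplen) xs in prm *.
have szp := perm_size prm; have szu : size us = size xs by rewrite size_map.
have szq : size qs = size xs by rewrite size_map.
have eqp : ps = insertion_sort qs.
  apply: (sorted_eq le_trans le_anti) => //.
    exact: insertion_sort_sorted.
  by rewrite (perm_trans prm) // perm_sym perm_insertion_sort.
have szm : size (topmask us) = size qs by rewrite size_topmask szu szq.
have := relaxed_sort szm; rewrite -eqp relaxedE; last by rewrite szm szp.
have [t tN Gt] := sparse_gain srt (topmask_sparse us).
move=> H1 H2; exists t => //; move: Gt H1 H2.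
set S := \sum_(i < size ps) _.
have -> : (0 < size ps)%N && head false (topmask us) = head false (topmask us).
  by case: (xs) szp szq szu szm => [|x xs'] szp szq szu; rewrite szp szq // => /size0nil ->.
rewrite addr0 subrr normr0 subr0 mulr0 add0r szp szq.
set h := (if _ then _ else _); set G := relaxed _ _.
by move=> le_gain le_relaxed le_end; lra.
Qed.

(** The largest minimiser: the strict inequality makes both parts of the first
    split job positive. *)
Definition best_prefix ps m :=
  (m <= size ps)%N /\
  forall t, (t <= size ps)%N ->
    gain ps m <= gain ps t /\ ((m < t)%N -> gain ps m < gain ps t).

(** Subtracting from [p + s] a number between 0 and [p + s] stays in that interval, which the sorted
    order only enlarges. So the machine due for the next whole job is never the more loaded one. *)
Lemma gap_bounds ps i : sorted <=%R ps -> all (fun p => 0 < p) ps ->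
  (i < size ps)%N -> 0 <= gap ps i <= ps`_i + s.
Proof.
move=> srt /(all_nthP 0) pos; have s0 := s_gt0.
elim: i => [|i IH] lti /=.
  by rewrite lexx /= addr_ge0 ?ltW ?pos.
have /andP[g0 g1] := IH (ltnW lti).
have := nth_sorted srt (leqnSn i) lti.
by lra.
Qed.

(** One more whole job would strictly raise [gain], so [gap ps m.+1] exceeds [(size ps - m) * s] and
    hence [s]. The first split job can therefore fill the imbalance and still use both machines. *)
Lemma best_gap ps m : best_prefix ps m -> (m < size ps)%N ->
  gap ps m < ps`_m.
Proof.
case=> _ opt lt_m; have [_ /(_ (ltnSn m))] := opt m.+1 lt_m.
have : s <= (size ps - m)%:R * s.
  by rewrite ler_peMl ?(ltW s_gt0) // ler1n subn_gt0.
by rewrite /=; lra.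
Qed.

End Combinatorics.

(** * Schedules *)

Section Schedules.
Variables (R : realFieldType) (n : nat) (s : R) (p : 'I_n -> R).
Hypothesis s_gt0 : 0 < s.
Implicit Types (S : schedule R 2 n) (js : seq 'I_n).

Lemma completion_cons m (a : part R m n) (S : schedule R m n) j :
  completion (a :: S) j =
  if pjob a == j then Num.max (pend a) (completion S j) else completion S j.
Proof. by rewrite /completion big_cons. Qed.

Lemma completion_ge0 m (S : schedule R m n) j : 0 <= completion S j.
Proof.
elim: S => [|a S IH]; first by rewrite /completion big_nil.
by rewrite completion_cons; case: ifP => // _; rewrite le_max IH orbT.
Qed.

Lemma pend_le_completion m (S : schedule R m n) :
  all (fun a => pend a <= completion S (pjob a)) S.
Proof.
elim: S => //= a S IH; rewrite completion_cons eqxx le_max lexx /=.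
apply: sub_all IH => b le_b; rewrite completion_cons.
by case: ifP => // _; rewrite le_max le_b orbT.
Qed.

Lemma total_completion_cons m (a : part R m n) (S : schedule R m n) :
  0 <= pend a -> total_completion (a :: S) <= pend a + total_completion S.
Proof.
move=> a0; rewrite /total_completion (bigD1 (pjob a)) //=.
rewrite [X in _ <= _ + X](bigD1 (pjob a)) //= addrA lerD //.
  rewrite completion_cons eqxx ge_max lerDl completion_ge0.
  by rewrite lerDr.
apply: ler_sum => j nj; rewrite completion_cons eq_sym.
by rewrite (negbTE nj).
Qed.

Lemma total_completion_dup m (a b : part R m n) (S : schedule R m n) :
  pjob a = pjob b -> pend a = pend b ->
  total_completion [:: a, b & S] = total_completion (b :: S).
Proof.
move=> eqj eqe; apply: eq_bigr => j _; rewrite !completion_cons eqj eqe.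
by case: (pjob b == j); rewrite // maxA maxxx.
Qed.

(** As in quicksort: the parts other than the first lie either entirely before
    or entirely after it. *)
Lemma loads_fit (lo C : R) (h : 'I_2) S :
  lo <= C ->
  all (fun a => [&& part_ok s a, pmach a == h, lo <= psetup a & pend a <= C]) S ->
  pairwise (@compatible R 2 n) S ->
  \sum_(a <- S) (s + plen a) <= C - lo.
Proof.
have [k le_k] := ubnP (size S); elim: k S lo C le_k => // k IH [|a S] lo C /=.
  by rewrite big_nil subr_ge0.
rewrite ltnS => szS _ /andP[/and4P[ok_a mach_a lo_a C_a] allS].
move=> /andP[compat_a compatS].
have [s0 s_le le_a]: [/\ 0 < s, psetup a + s + plen a <= pend a & 0 < plen a].
  by case/and3P: ok_a => ? ? ?; split=> //; rewrite lerD2r.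
rewrite big_cons (bigID (fun b => pend b <= psetup a)) /= -!(big_filter S).
have fitl : \sum_(b <- [seq b <- S | pend b <= psetup a]) (s + plen b)
            <= psetup a - lo.
  apply: IH; rewrite ?pairwise_filter ?lo_a //.
    by apply: leq_ltn_trans szS; rewrite size_filter count_size.
  rewrite all_filter; apply: sub_all allS => b /and4P[ok_b mach_b lo_b C_b].
  by apply/implyP => le_b; apply/and4P.
have fitr : \sum_(b <- [seq b <- S | ~~ (pend b <= psetup a)]) (s + plen b)
            <= C - pend a.
  apply: IH; rewrite ?pairwise_filter //.
    by apply: leq_ltn_trans szS; rewrite size_filter count_size.
  rewrite all_filter; have := allS; rewrite -(andbT (all _ S)).
  move/andP=> [/(conj compat_a)/andP]; rewrite -all_predI => + _.
  apply: sub_all => b /= /andP[cab /and4P[ok_b mach_b lo_b C_b]].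
  apply/implyP => not_le; apply/and4P; split=> //.
  move: cab; rewrite /compatible (eqP mach_a) (eqP mach_b) eqxx /=.
  by rewrite (negbTE not_le) orbF.
by lra.
Qed.

(** * Loads in a feasible schedule *)

Definition mach (h : bool) : 'I_2 := if h then ord_max else ord0.
Arguments mach : simpl never.

Definition load S (h : bool) (j : 'I_n) : R :=
  \sum_(a <- S | (pjob a == j) && (pmach a == mach h)) (s + plen a).

Lemma sum_load S h js : uniq js ->
  \sum_(j <- js) load S h j =
  \sum_(a <- [seq a <- S | (pjob a \in js) && (pmach a == mach h)])
    (s + plen a).
Proof.
move=> uq; rewrite big_filter (exchange_big_dep predT) //=.
rewrite [RHS]big_mkcond /=; apply: eq_bigr => a _.
case: (boolP (pmach a == mach h)) => _; rewrite ?andbF ?andbT; last first.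
  by rewrite big_pred0 // => j; rewrite andbF.
under eq_bigl do rewrite andbT eq_sym.
rewrite -big_filter; case: (boolP (pjob a \in js)) => in_js.
  by rewrite filter_pred1_uniq // big_seq1.
have -> : [seq i <- js | i == pjob a] = [::]; last by rewrite big_nil.
apply/eqP; rewrite -[_ == _]negbK -has_filter; apply/negP=> /hasP[j jin /eqP E].
by rewrite -E jin in in_js.
Qed.

Lemma load_le S h js C : all (part_ok s) S -> pairwise (@compatible R 2 n) S ->
  uniq js -> 0 <= C -> {in js, forall j, completion S j <= C} ->
  \sum_(j <- js) load S h j <= C.
Proof.
move=> ok cmp uq C0 le_C; rewrite sum_load // -[C]subr0.
apply: (@loads_fit 0 C (mach h)); rewrite ?pairwise_filter //.
rewrite all_filter; have := pend_le_completion S.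
move=> ends; have : all (predI (part_ok s) (fun a => pend a <= completion S (pjob a))) S.
  by rewrite all_predI ok.
apply: sub_all => a /= /andP[ok_a end_a].
apply/implyP => /andP[jin mach_a]; rewrite ok_a mach_a /=.
by case/and3P: ok_a => _ -> _; exact: le_trans end_a (le_C _ jin).
Qed.

(** Without parts both sums vanish; otherwise at least one setup is paid, whatever the number of
    parts. *)
Lemma load_cases S (P : pred (part R 2 n)) : all (part_ok s) S ->
  let L := \sum_(a <- S | P a) (s + plen a) in
  let Q := \sum_(a <- S | P a) plen a in
  (L = 0 /\ Q = 0) \/ (0 <= Q /\ s + Q <= L).
Proof.
move=> + /=; have s0 := s_gt0; elim: S => [|a S IH] /=.
  by rewrite !big_nil; left.
move=> /andP[ok_a /IH]; rewrite !big_cons; case: (P a) => // H; right.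
have : 0 < plen a by case/and3P: ok_a.
set L := \sum_(_ <- _ | _) (_ + _) in H *; set Q := \sum_(_ <- _ | _) _ in H *.
by case: H => [[-> ->]|[? ?]] pa; split; lra.
Qed.

Definition schedule_step S (j : 'I_n) : step R :=
  Step (p j) (load S false j) (load S true j) (completion S j)
    ((load S false j == 0) || (load S true j == 0)).

Lemma mach_cases (h : 'I_2) : (h == mach true) = ~~ (h == mach false).
Proof. by case: h => [[|[]]]. Qed.

(** The induction collects finished jobs in [pre]. When [j] completes, all of [pre] has completed
    too, so on each machine their loads and that of [j] fit before [completion S j]. *)
Lemma schedule_walk S pre suf : feasible s p S ->
  (forall j, j \in suf -> 0 < p j) ->
  uniq (pre ++ suf) ->
  sorted (fun i j => completion S i <= completion S j) (pre ++ suf) ->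
  walk s (\sum_(j <- pre) load S false j) (\sum_(j <- pre) load S true j)
    [seq schedule_step S j | j <- suf].
Proof.
case/and3P=> ok cmp /forallP sums.
elim: suf pre => [|j suf IH] pre //= pos uq srt.
have [uqj pre_le] : uniq (rcons pre j) /\
    {in rcons pre j, forall i, completion S i <= completion S j}.
  move: uq srt; rewrite -cat_rcons cat_uniq => /andP[uqj _].
  rewrite sorted_pairwise; last by move=> ? ? ?; exact: le_trans.
  rewrite pairwise_cat pairwise_rcons => /and3P[_ /andP[le_j _] _].
  split=> // i; rewrite mem_rcons inE => /predU1P[->//|].
  by move/allP: le_j; apply.
have fit h : \sum_(i <- pre) load S h i + load S h j <= completion S j.
  have := load_le h ok cmp uqj (completion_ge0 S j) pre_le.
  by rewrite big_rcons.
have s0 := s_gt0.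
split=> /=; [exact: fit | exact: fit | | ]; last first.
  have := IH (rcons pre j); rewrite cat_rcons !big_rcons /=.
  by apply=> // i i_in; apply: pos; rewrite inE i_in orbT.
have pj : 0 < p j by apply: pos; rewrite mem_head.
have := sums j; rewrite (bigID (fun a => pmach a == mach false)) /=.
have := load_cases (fun a => (pjob a == j) && (pmach a == mach false)) ok.
have := load_cases (fun a => (pjob a == j) && (pmach a == mach true)) ok.
rewrite /= -!/(load S _ j).
under [X in _ + X == _]eq_bigl do rewrite -mach_cases.
set Q1 := \sum_(_ <- _ | _ && (_ == mach true)) plen _.
set Q0 := \sum_(_ <- _ | _ && (_ == mach false)) plen _.
(* Two machines without a part contradict [0 < p j]; one makes the job whole; none means two
   setups. *)
move=> [[-> Q1E]|[Q1E L1E]] [[-> Q0E]|[Q0E L0E]] /eqP Qp.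
- by exfalso; lra.
- rewrite eqxx orbT subr0 addr0 ger0_norm; last by lra.
  by split; lra.
- rewrite eqxx sub0r normrN add0r ger0_norm; last by lra.
  by split; lra.
by rewrite !gt_eqF /=; lra.
Qed.

(** * The constructed schedule *)

(** [X] and [Y] are the loads of machine [h] and of the other one; [h] is the one
    that gets the next whole job. *)
Fixpoint build (m : nat) (X Y : R) (h : bool) js : schedule R 2 n :=
  if js is j :: js' then
    if m is m'.+1 then
      Part j (mach h) X (X + s) (p j)
      :: build m' Y (X + s + p j) (~~ h) js'
    else
      let T := (X + Y + p j + s + s) / 2 in
      [:: Part j (mach h) X (X + s) (T - X - s),
          Part j (mach (~~ h)) Y (Y + s) (T - Y - s)
        & build 0 T T h js']
  else [::].

(** The parts of a split job have lengths [(p j + Y - X) / 2] and [(p j + X - Y) / 2], both positive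
    exactly when [p j] exceeds the distance of [X] and [Y]. *)
Fixpoint splittable (m : nat) (X Y : R) js : bool :=
  if js is j :: js' then
    if m is m'.+1 then (0 < p j) && splittable m' Y (X + s + p j) js'
    else
      let T := (X + Y + p j + s + s) / 2 in
      (`|Y - X| < p j) && splittable 0 T T js'
  else true.

(** The third claim carries the induction: later setups start no earlier than the loads reached, so
    the parts already placed are compatible with them. *)
Lemma build_feasible m (X Y : R) h js : splittable m X Y js -> 0 <= X -> 0 <= Y ->
  [/\ all (part_ok s) (build m X Y h js),
      pairwise (@compatible R 2 n) (build m X Y h js)
    & all (fun a => (if pmach a == mach h then X else Y) <= psetup a)
        (build m X Y h js)].
Proof.
have s0 := s_gt0.
have machN b : (mach (~~ b) == mach b) = false by case: b.
have machC b (k : 'I_2) : (k == mach (~~ b)) = ~~ (k == mach b).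
  by case: b; rewrite /= mach_cases ?negbK.
elim: js m X Y h => [|j js IH] [|m] X Y h //=.
- case/andP=> gapj; set T := _ / 2; have TE : 2 * T = X + Y + p j + s + s.
    by rewrite /T; field.
  have [XT YT] : X + s < T /\ Y + s < T.
    by move: gapj; rewrite ltr_norml => /andP[? ?]; split; lra.
  move=> /(IH _ _ _ h) {}IH X0 Y0; have [||ok cmp low] := IH; try lra.
  have low' : all (fun a => T <= psetup a) (build 0 T T h js).
    by apply: sub_all low => a; case: ifP.
  rewrite ok cmp /part_ok /= !lexx eqxx machN lexx X0 Y0 /=.
  have /andP[-> ->] : (0 < T - X - s) && (0 < T - Y - s).
    by apply/andP; split; lra.
  split=> //=; last first.
    by rewrite lexx; apply: sub_all low' => a; case: ifP => _ ?; lra.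
  rewrite [compatible _ (Part _ _ _ _ _)]/compatible /= eq_sym machN /= andbT.
  apply/andP; split; apply: sub_all low' => a Ta; rewrite /compatible /pend /=;
    by apply/implyP => _; apply/orP; left; lra.
case/andP=> pj /(IH _ _ _ (~~ h)) {}IH X0 Y0.
have [||ok cmp low] := IH; try lra.
rewrite ok cmp /part_ok /= lexx eqxx X0 pj lexx /= andbT.
split=> //; apply: sub_all low => a; rewrite machC /compatible /pend /=.
  rewrite eq_sym; case: eqP => //= _ le_a.
  by apply/orP; left; lra.
by case: eqP => //= _; lra.
Qed.

Lemma build_plen m X Y h js j :
  \sum_(a <- build m X Y h js | pjob a == j) plen a =
  (count_mem j js)%:R * p j.
Proof.
elim: js m X Y h => [|i js IH] [|m] X Y h /=; rewrite ?big_nil ?mul0r //.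
  rewrite !big_cons /= IH; case: eqP => [->|_] /=; last by rewrite add0n.
  by rewrite natrD; field.
rewrite big_cons /= IH; case: eqP => [->|_] /=; last by rewrite add0n.
by rewrite natrD; ring.
Qed.

Lemma base_cons x (ps : seq R) :
  base s (x :: ps) = (size ps).+1%:R * (x + 2 * s) + base s ps.
Proof. by rewrite /base /= big_ord_recl subn0. Qed.

(** Both parts of a job end at [T], and [2 * T] is the new total load. Each job raises that load by
    [p j + 2 * s] for itself and all later jobs, which sums to [base]. *)
Lemma build0_cost (X Y : R) h js : 0 <= X -> 0 <= Y -> {in js, forall j, 0 < p j} ->
  2 * total_completion (build 0 X Y h js) <=
  (size js)%:R * (X + Y) + base s [seq p j | j <- js].
Proof.
have s0 := s_gt0.
elim: js X Y h => [|j js IH] X Y h X0 Y0 pos.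
  rewrite /total_completion /base /= big_ord0 big1 ?mulr0 ?mul0r ?addr0 //.
  by move=> i _; rewrite /completion big_nil.
rewrite [build _ _ _ _ _]/=; set T := _ / 2.
have TE : 2 * T = X + Y + p j + s + s by rewrite /T; field.
have pj : 0 < p j by apply: pos; rewrite mem_head.
have T0 : 0 <= T by lra.
rewrite total_completion_dup //; last by rewrite /pend /=; ring.
have := total_completion_cons (build 0 T T h js) (_ : 0 <= pend (Part j (mach (~~ h)) Y (Y + s) (T - Y - s))).
have -> : pend (Part j (mach (~~ h)) Y (Y + s) (T - Y - s)) = T.
  by rewrite /pend /=; ring.
move=> /(_ T0) le_tot.
have {IH} := IH _ _ h T0 T0 (fun i i_in => pos i (mem_behead (s := j :: js) i_in)).
rewrite [map _ (j :: js)]/= base_cons size_map [size (j :: js)]/= -[(size js).+1%:R]natr1.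
set W := (size js)%:R; set B := base _ _ => IH.
have -> : (W + 1) * (X + Y) = (W + 1) * (2 * T - p j - s - s).
  by rewrite TE; ring.
set c := total_completion _ in le_tot *; set d := total_completion _ in le_tot IH.
by lra.
Qed.

(** Here [i] whole jobs are already placed. Twice the end of the next one is the new total load plus
    the new gap, and compared with a split one setup is saved for each of the [size ps - i] jobs
    left: the two terms of [gain]. *)
Lemma build_cost m ps i (X Y : R) h js : 0 <= X -> 0 <= Y ->
  {in js, forall j, 0 < p j} -> [seq p j | j <- js] = drop i ps ->
  (i <= m <= size ps)%N -> Y - X = gap s ps i ->
  2 * total_completion (build (m - i) X Y h js) <=
  (size js)%:R * (X + Y) + base s [seq p j | j <- js] + gain s ps m - gain s ps i.
Proof.
have s0 := s_gt0.
elim: js i X Y h => [|j js IH] i X Y h X0 Y0 pos eq_ps.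
  move=> /andP[im mps] _.
  have -> : m = i.
    by have := congr1 size eq_ps; rewrite /= size_drop; lia.
  have := build0_cost h X0 Y0 pos; rewrite addrK => /le_trans; apply.
  by rewrite lexx.
rewrite leq_eqVlt => /andP[/predU1P[<-|im] mps] gapE.
  by rewrite addrK subnn; exact: build0_cost.
have pj : 0 < p j by apply: pos; rewrite mem_head.
rewrite -subnSK //= -/build.
have eq_ps' : [seq p i0 | i0 <- js] = drop i.+1 ps.
  by rewrite -[i.+1]add1n -drop_drop -eq_ps /= drop0.
have pi : ps`_i = p j by rewrite -[i]addn0 -nth_drop -eq_ps.
have {IH} := IH i.+1 Y (X + s + p j) (~~ h) Y0 _
  (fun i i_in => pos i (mem_behead (s := j :: js) i_in)) eq_ps' _ _.
have -> : (0 <= X + s + p j) by lra.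
rewrite im mps => /(_ isT isT); rewrite [gap _ _ i.+1]/= -gapE pi => IH.
have {}IH := IH (_ : X + s + p j - Y = p j + s - (Y - X)).
have := total_completion_cons (build (m - i.+1) Y (X + s + p j) (~~ h) js)
  (_ : 0 <= pend (Part j (mach h) X (X + s) (p j))).
rewrite /pend /=; have -> : 0 <= X + s + p j by lra.
move=> /(_ isT) le_tot.
have szE : (size ps - i)%N = (size js).+1.
  by have := congr1 size eq_ps; rewrite /= size_map size_drop.
have {}IH := IH (ltac:(ring)).
move: IH; rewrite [gain _ _ i.+1]/= base_cons size_map szE.
rewrite -[(size js).+1%:R]natr1 -gapE pi.
set W := (size js)%:R; set B := base _ _ => IH.
set c := total_completion _ in le_tot *.
set d := total_completion _ in le_tot IH.
by lra.
Qed.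

(** Only the first split job meets an imbalance, bounded by [best_gap]; after it the loads are
    equal. *)
Lemma best_splittable m ps i (X Y : R) js :
  sorted <=%R ps -> all (fun x => 0 < x) ps -> best_prefix s ps m ->
  [seq p j | j <- js] = drop i ps -> (i <= m)%N -> Y - X = gap s ps i ->
  splittable (m - i) X Y js.
Proof.
move=> srt pos best; have s0 := s_gt0.
have split0 T js' : {in js', forall j, 0 < p j} -> splittable 0 T T js'.
  elim: js' T => //= j js' IH T posj.
  rewrite subrr normr0 posj ?mem_head //=; apply: IH => k k_in.
  by apply: posj; rewrite inE k_in orbT.
elim: js i X Y => [|j js IH] i X Y //= eq_ps im gapE.
have posj : {in j :: js, forall j, 0 < p j}.
  move=> k k_in; have : p k \in drop i ps by rewrite -eq_ps -map_cons map_f.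
  by move/mem_drop; apply: (allP pos).
have i_lt : (i < size ps)%N.
  by have := congr1 size eq_ps; rewrite /= size_drop; lia.
have pi : ps`_i = p j by rewrite -[i]addn0 -nth_drop -eq_ps.
move: im; rewrite leq_eqVlt => /predU1P[im|im].
  rewrite im subnn gapE; apply/andP; split.
    have /andP[g0 _] := gap_bounds s_gt0 srt pos i_lt.
    by rewrite ger0_norm // -pi; subst i; exact: (best_gap s_gt0 best).
  by apply: split0 => k k_in; apply: posj; rewrite inE k_in orbT.
rewrite -subnSK //= posj ?mem_head //=; apply: IH => //.
  by rewrite -[i.+1]add1n -drop_drop -eq_ps /= drop0.
by rewrite [gap _ _ i.+1]/= pi -gapE; ring.
Qed.

Lemma build_optimal m js :
  uniq js -> (forall j, 0 <= p j) -> (forall j, (j \in js) = (0 < p j)) ->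
  sorted <=%R [seq p j | j <- js] -> best_prefix s [seq p j | j <- js] m ->
  optimal s p (build m 0 0 false js).
Proof.
move=> uq p_ge0 mem_js srt best; set ps := map p js in srt best.
have s0 := s_gt0; have [m_le best_m] := best.
have pos : {in js, forall j, 0 < p j} by move=> j; rewrite mem_js.
have pos_ps : all (fun x => 0 < x) ps.
  by rewrite all_map; apply/allP => j /pos.
have eq_ps : [seq p j | j <- js] = drop 0 ps by rewrite drop0.
have split_js : splittable m 0 0 js.
  rewrite -[m]subn0; apply: best_splittable eq_ps _ _ => //.
  by rewrite subrr.
have cost := @build_cost m ps 0 0 0 false js (lexx 0) (lexx 0) pos eq_ps m_le
  (subrr 0).
split=> [|S feas].
  have [ok cmp _] := build_feasible false split_js (lexx 0) (lexx 0).
  rewrite /feasible ok cmp /=; apply/forallP => j; rewrite build_plen.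
  rewrite count_uniq_mem // mem_js; case: ltP => [_|]; first by rewrite mul1r.
  by rewrite mul0r => pj; rewrite eq_le p_ge0.
pose before i j := completion S i <= completion S j.
pose ord := sort before js.
have before_total : total before by move=> i j; exact: le_total.
have ord_js : perm_eq ord js by rewrite perm_sort.
have wk := @schedule_walk S [::] ord feas _ _ (sort_sorted before_total _).
have {wk} := wk _ _; rewrite !big_nil.
rewrite /= (perm_uniq ord_js) uq => wk.
have {}wk := wk (fun j j_in => pos j (eq_ind _ is_true j_in _ (perm_mem ord_js j))) isT.
have := walk_gain s_gt0 wk srt.
rewrite -map_comp big_map => /(_ _)[|t t_le le_S].
  by rewrite perm_sym; exact: perm_map.
have [best_t _] := best_m t t_le.
(* Jobs of length 0, absent from [ord], only add nonnegative completion times. *)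
have tot : \sum_(j <- ord) completion S j <= total_completion S.
  rewrite (perm_big _ ord_js) big_uniq //= /total_completion.
  rewrite [X in _ <= X](bigID (mem js)) /= lerDl.
  by apply: sumr_ge0 => j _; exact: completion_ge0.
move: cost le_S; rewrite subn0 addr0 mulr0 add0r subr0 -/ps /=.
by move=> cost le_S; lra.
Qed.
End Schedules.

Arguments mach : simpl never.

(** * Execution of programs *)

Section Execution.
Variable R : realFieldType.
Implicit Types (st : state R) (Q : state R -> Prop).

Fixpoint loopfree c : bool :=
  match c with
  | Seq c1 c2 | If _ c1 c2 => loopfree c1 && loopfree c2
  | While _ _ => false
  | _ => true
  end.

(** A functional interpreter for loop-free programs; the branch for [While] is a dummy. *)
Fixpoint run c st : state R :=
  match c with
  | IStore a e => State (upd (imem st) (ieval st a) (ieval st e)) (rmem st)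
  | RStore a e => State (imem st) (upd (rmem st) (ieval st a) (reval st e))
  | Seq c1 c2 => run c2 (run c1 st)
  | If b c1 c2 => if beval st b then run c1 st else run c2 st
  | Skip | While _ _ => st
  end.

(** For [If] the costs of both branches are added, which bounds either one. *)
Fixpoint wcost c : nat :=
  match c with
  | Skip | While _ _ => 1
  | IStore a e => (icost a + icost e).+1
  | RStore a e => (icost a + rcost e).+1
  | Seq c1 c2 => wcost c1 + wcost c2
  | If b c1 c2 => bcost b + (wcost c1 + wcost c2)
  end.

Definition reach c st (K : nat) Q :=
  exists t st', [/\ exec c st t st', (t <= K)%N & Q st'].

Lemma reach_run c st Q : loopfree c -> Q (run c st) -> reach c st (wcost c) Q.
Proof.
elim: c st Q => [|a e|a e|c1 IH1 c2 IH2|b c1 IH1 c2 IH2|] st Q //=.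
- by move=> _ ?; exists 1%N, st; split=> //; constructor.
- by move=> _ ?; do 2!eexists; split; [constructor | exact: leqnn |].
- by move=> _ ?; do 2!eexists; split; [constructor | exact: leqnn |].
- case/andP=> l1 l2 q.
  have [t1 [st1 [e1 le1 E1]]] := IH1 st (eq (run c1 st)) l1 erefl; subst st1.
  have [t2 [st2 [e2 le2 q2]]] := IH2 (run c1 st) Q l2 q.
  by exists (t1 + t2)%N, st2; split; [econstructor; eauto | exact: leq_add |].
case/andP=> l1 l2 q.
case: (boolP (beval st b)) q => [bT|bF] q.
  have [t [st' [e le q']]] := IH1 st Q l1 q.
  exists (bcost b + t)%N, st'; split=> //; first by constructor; rewrite bT.
  by rewrite leq_add2l; apply: leq_trans le (leq_addr _ _).
have [t [st' [e le q']]] := IH2 st Q l2 q.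
exists (bcost b + t)%N, st'; split=> //.
  by constructor; rewrite (negbTE bF).
by rewrite leq_add2l; apply: leq_trans le (leq_addl _ _).
Qed.

Lemma reach_seq c1 c2 st K1 K2 Q1 Q2 :
  reach c1 st K1 Q1 -> (forall st1, Q1 st1 -> reach c2 st1 K2 Q2) ->
  reach (Seq c1 c2) st (K1 + K2) Q2.
Proof.
case=> t1 [st1 [e1 le1 q1]] /(_ _ q1) [t2 [st2 [e2 le2 q2]]].
by exists (t1 + t2)%N, st2; split; [econstructor; eauto | exact: leq_add |].
Qed.

Lemma reach_weaken c st K K' Q Q' : (K <= K')%N -> (forall st', Q st' -> Q' st') ->
  reach c st K Q -> reach c st K' Q'.
Proof.
move=> leK impl [t [st' [e le q]]].
by exists t, st'; split; [| exact: leq_trans le leK | exact: impl].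
Qed.

Lemma reach_le c st K K' Q : reach c st K Q -> (K <= K')%N -> reach c st K' Q.
Proof. by move=> rch le_K; apply: reach_weaken rch. Qed.

(** The index of the invariant drops in every round, so its initial value bounds the number of
    rounds. *)
Lemma reach_while (I : nat -> state R -> Prop) b c K k st :
  (forall k st, I k st -> beval st b ->
     reach c st K (fun st' => exists2 k', (k' < k)%N & I k' st')) ->
  I k st ->
  reach (While b c) st (k * (bcost b + K) + bcost b)
    (fun st' => ~~ beval st' b /\ exists k', I k' st').
Proof.
move=> body; have [m le_m] := ubnP k; elim: m k st le_m => // m IH k st.
rewrite ltnS => le_m Ik; case: (boolP (beval st b)) => [bT|bF]; last first.
  exists (bcost b), st; split; [by constructor | by rewrite leq_addl |].
  by split=> //; exists k.
have [t1 [st1 [e1 le1 [k' lt_k' Ik']]]] := body _ _ Ik bT.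
have [t2 [st2 [e2 le2 q2]]] := IH _ _ (leq_trans lt_k' le_m) Ik'.
exists (bcost b + t1 + t2)%N, st2; split=> //; first by econstructor; eauto.
apply: (@leq_trans (k'.+1 * (bcost b + K) + bcost b)); last first.
  by rewrite leq_add2r leq_mul2r lt_k' orbT.
by rewrite mulSn; move: (k' * _)%N le2 => x; lia.
Qed.
End Execution.

Arguments run : simpl never.
Arguments wcost : simpl never.
Arguments ieval : simpl never.
Arguments reval : simpl never.
Arguments beval : simpl never.
Arguments upd {V} f k v i /.

(** * Memory layout *)

(** The program for [n] jobs keeps the output in the integer cells [1..4n] and
    the real cells [0..6n], so its own data have to live above these: 20 scalars
    followed by arrays (two interleaved ones in the integer memory). *)
Record layout (R : Type) := Layout {
  scalar : nat -> nat;
  arrA : nat -> nat;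
  arrB : nat -> nat;
  rscalar : nat -> R;
  lens : nat -> R;
  iout : nat -> nat;
  rout : nat -> R
}.

Section Layouts.
Variables (R : realFieldType) (n : nat).

Definition conc (a : layout R) : state R :=
  State
    (fun x => if x == 0 then n else if x <= 4 * n then iout a x
      else let y := x - (4 * n + 1) in
      if y < 20 then scalar a y
      else if odd y then arrB a (y - 20)./2 else arrA a (y - 20)./2)%N
    (fun x => if x <= 6 * n then rout a x
      else let y := x - (6 * n + 1) in
      if y < 20 then rscalar a y else lens a (y - 20))%N.
End Layouts.

Definition nE := ILoad (IConst 0).
(** Addresses are computed from [n] in integer cell 0, so one program serves all [n]; multiples are
    sums because integer expressions have no product. *)
Definition n4E := IAdd (IAdd nE nE) (IAdd nE nE).
Definition n6E := IAdd n4E (IAdd nE nE).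
Definition ivA (c : nat) := IAdd n4E (IConst c.+1).
Definition rvA (c : nat) := IAdd n6E (IConst c.+1).
Definition aA (e : iexp) := IAdd (IAdd n4E (IConst 21)) (IAdd e e).
Definition bA (e : iexp) := IAdd (IAdd n4E (IConst 22)) (IAdd e e).
Definition lenA (e : iexp) := IAdd (IAdd n6E (IConst 21)) e.
Definition iv c := ILoad (ivA c).
Definition rv c := RLoad (rvA c).
Definition arrAE e := ILoad (aA e).
Definition arrBE e := ILoad (bA e).
Definition lenE e := RLoad (lenA e).

Section LayoutSemantics.
Variables (R : realFieldType) (n : nat).
Variables (f A B : nat -> nat) (r P : nat -> R) (o : nat -> nat) (q : nat -> R).
Let st := conc n (Layout f A B r P o q).

Lemma conc_n : ieval st nE = n. Proof. by []. Qed.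
Lemma ieval_const c : ieval st (IConst c) = c. Proof. by []. Qed.
Lemma ieval_add e1 e2 : ieval st (IAdd e1 e2) = (ieval st e1 + ieval st e2)%N.
Proof. by []. Qed.
Lemma ieval_sub e1 e2 : ieval st (ISub e1 e2) = (ieval st e1 - ieval st e2)%N.
Proof. by []. Qed.
Lemma reval_add e1 e2 : reval st (RAdd e1 e2) = reval st e1 + reval st e2.
Proof. by []. Qed.
Lemma reval_sub e1 e2 : reval st (RSub e1 e2) = reval st e1 - reval st e2.
Proof. by []. Qed.
Lemma reval_div e1 e2 : reval st (RDiv e1 e2) = reval st e1 / reval st e2.
Proof. by []. Qed.
Lemma reval_zero : reval st RZero = 0. Proof. by []. Qed.
Lemma reval_one : reval st ROne = 1. Proof. by []. Qed.
Lemma beval_ile e1 e2 : beval st (ILe e1 e2) = (ieval st e1 <= ieval st e2)%N.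
Proof. by []. Qed.
Lemma beval_rle e1 e2 : beval st (RLe e1 e2) = (reval st e1 <= reval st e2).
Proof. by []. Qed.

Lemma ieval_n4 : ieval st n4E = (4 * n)%N.
Proof. by rewrite /n4E !ieval_add !conc_n; lia. Qed.
Lemma ieval_n6 : ieval st n6E = (6 * n)%N.
Proof. by rewrite ieval_add ieval_n4 ieval_add !conc_n; lia. Qed.

Lemma ieval_scalar c : (c < 20)%N -> ieval st (iv c) = f c.
Proof.
move=> c20; rewrite [LHS](_ : _ = imem st (ieval st (ivA c))) //.
rewrite ieval_add ieval_n4 ieval_const /= ifF; last by lia.
rewrite ifF; last by lia.
have -> : (4 * n + c.+1 - (4 * n + 1) = c)%N by lia.
by rewrite c20.
Qed.

Lemma ieval_arrA e : ieval st (arrAE e) = A (ieval st e).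
Proof.
rewrite [LHS](_ : _ = imem st (ieval st (aA e))) //.
rewrite 2!ieval_add ieval_n4 ieval_const ieval_add /= ifF; last by lia.
set x := ieval st e; rewrite ifF; last by lia.
rewrite (_ : (_ - _)%N = (20 + x.*2)%N); last by lia.
by rewrite ifF; [congr A; lia | rewrite oddD odd_double].
Qed.

Lemma ieval_arrB e : ieval st (arrBE e) = B (ieval st e).
Proof.
rewrite [LHS](_ : _ = imem st (ieval st (bA e))) //.
rewrite 2!ieval_add ieval_n4 ieval_const ieval_add /= ifF; last by lia.
set x := ieval st e; rewrite ifF; last by lia.
rewrite (_ : (_ - _)%N = (21 + x.*2)%N); last by lia.
by rewrite ifT; [congr B; lia | rewrite oddD odd_double].
Qed.

Lemma reval_scalar c : (c < 20)%N -> reval st (rv c) = r c.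
Proof.
move=> c20; rewrite [LHS](_ : _ = rmem st (ieval st (rvA c))) //.
rewrite ieval_add ieval_n6 ieval_const /= ifF; last by lia.
have -> : (6 * n + c.+1 - (6 * n + 1) = c)%N by lia.
by rewrite c20.
Qed.

Lemma reval_len e : reval st (lenE e) = P (ieval st e).
Proof.
rewrite [LHS](_ : _ = rmem st (ieval st (lenA e))) //.
rewrite 2!ieval_add ieval_n6 ieval_const /= ifF; last by lia.
set x := ieval st e; rewrite ifF; last by lia.
by congr P; lia.
Qed.

Lemma reval_rout e : (ieval st e <= 6 * n)%N -> reval st (RLoad e) = q (ieval st e).
Proof.
move=> le_e; rewrite [LHS](_ : _ = rmem st (ieval st e)) //.
by rewrite /= le_e.
Qed.

Lemma state_eq (st1 st2 : state R) :
  imem st1 =1 imem st2 -> rmem st1 =1 rmem st2 -> st1 = st2.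
Proof.
case: st1 st2 => i1 r1 [i2 r2] /= E1 E2.
by congr State; apply: functional_extensionality.
Qed.

Lemma run_scalar c e : (c < 20)%N ->
  run (IStore (ivA c) e) st = conc n (Layout (upd f c (ieval st e)) A B r P o q).
Proof.
move=> c20; apply: state_eq => x; rewrite /run //=.
rewrite ieval_add ieval_n4 ieval_const.
case: (x =P _) => [->|nx].
  rewrite ifF; last by lia.
  rewrite ifF; last by lia.
  have -> : (4 * n + c.+1 - (4 * n + 1) = c)%N by lia.
  by rewrite c20 eqxx.
case: (x =P 0)%N => // x0; case: (leqP x (4 * n)) => // lt_x.
by case: (_ =P c) => // E; exfalso; lia.
Qed.

Lemma run_arrA e1 e2 :
  run (IStore (aA e1) e2) st =
  conc n (Layout f (upd A (ieval st e1) (ieval st e2)) B r P o q).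
Proof.
apply: state_eq => x; rewrite /run //=.
rewrite 2!ieval_add ieval_n4 ieval_const ieval_add; set y := ieval st e1.
case: (x =P _) => [->|nx].
  rewrite ifF; last by lia.
  rewrite ifF; last by lia.
  rewrite (_ : (_ - (4 * n + 1))%N = (20 + y.*2)%N); last by lia.
  rewrite ifF; last by rewrite oddD odd_double.
  by rewrite ifT //; apply/eqP; lia.
case: (x =P 0)%N => // x0; case: (leqP x (4 * n)) => // lt_x; case: (ltnP (x - _) 20) => // le_x.
case: ifP => // odd_x; rewrite ifF //.
by apply/negP => /eqP E; move: odd_x; lia.
Qed.

Lemma run_arrB e1 e2 :
  run (IStore (bA e1) e2) st =
  conc n (Layout f A (upd B (ieval st e1) (ieval st e2)) r P o q).
Proof.
apply: state_eq => x; rewrite /run //=.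
rewrite 2!ieval_add ieval_n4 ieval_const ieval_add; set y := ieval st e1.
case: (x =P _) => [->|nx].
  rewrite ifF; last by lia.
  rewrite ifF; last by lia.
  rewrite (_ : (_ - (4 * n + 1))%N = (21 + y.*2)%N); last by lia.
  rewrite ifT; last by rewrite oddD odd_double.
  by rewrite ifT //; apply/eqP; lia.
case: (x =P 0)%N => // x0; case: (leqP x (4 * n)) => // lt_x; case: (ltnP (x - _) 20) => // le_x.
case: ifP => // odd_x; rewrite ifF //.
by apply/negP => /eqP E; move: odd_x; lia.
Qed.

Lemma run_rscalar c e : (c < 20)%N ->
  run (RStore (rvA c) e) st = conc n (Layout f A B (upd r c (reval st e)) P o q).
Proof.
move=> c20; apply: state_eq => x; rewrite /run //=.
rewrite ieval_add ieval_n6 ieval_const.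
case: (x =P _) => [->|nx].
  rewrite ifF; last by lia.
  have -> : (6 * n + c.+1 - (6 * n + 1) = c)%N by lia.
  by rewrite c20 eqxx.
case: (leqP x (6 * n)) => // lt_x.
by case: (_ =P c) => // E; exfalso; lia.
Qed.

Lemma run_len e1 e2 :
  run (RStore (lenA e1) e2) st =
  conc n (Layout f A B r (upd P (ieval st e1) (reval st e2)) o q).
Proof.
apply: state_eq => x; rewrite /run //=.
rewrite 2!ieval_add ieval_n6 ieval_const; set y := ieval st e1.
case: (x =P _) => [->|nx].
  rewrite ifF; last by lia.
  rewrite ifF; last by lia.
  by rewrite ifT //; apply/eqP; lia.
case: (leqP x (6 * n)) => // lt_x; case: (ltnP (x - _) 20) => // le_x.
by rewrite ifF //; apply/negP => /eqP E; lia.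
Qed.

Lemma run_iout e1 e2 : (0 < ieval st e1 <= 4 * n)%N ->
  run (IStore e1 e2) st =
  conc n (Layout f A B r P (upd o (ieval st e1) (ieval st e2)) q).
Proof.
move=> le_e; apply: state_eq => x; rewrite /run //=.
case: (x =P _) => [->|//].
rewrite ifF; last by lia.
by rewrite ifT; last by case/andP: le_e.
Qed.

Lemma run_rout e1 e2 : (ieval st e1 <= 6 * n)%N ->
  run (RStore e1 e2) st =
  conc n (Layout f A B r P o (upd q (ieval st e1) (reval st e2))).
Proof.
move=> le_e; apply: state_eq => x; rewrite /run //=.
by case: (x =P _) => [->|//]; rewrite ifT.
Qed.

End LayoutSemantics.

Lemma run_seq (R : realFieldType) c1 c2 (st : state R) :
  run (Seq c1 c2) st = run c2 (run c1 st).
Proof. by []. Qed.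

Lemma run_if (R : realFieldType) b c1 c2 (st : state R) :
  run (If b c1 c2) st = if beval st b then run c1 st else run c2 st.
Proof. by []. Qed.

Lemma run_skip (R : realFieldType) (st : state R) : run Skip st = st.
Proof. by []. Qed.

Arguments conc : simpl never.

Definition evalE := (ieval_scalar, reval_scalar, ieval_arrA, ieval_arrB, reval_len,
  ieval_const, ieval_add, ieval_sub, reval_add, reval_sub, reval_div, reval_zero,
  reval_one, beval_ile, beval_rle, conc_n).
Definition runE := (run_scalar, run_rscalar, run_arrA, run_arrB, run_len).

(** * Merge sort *)

Section MergeSort.
Variables (T : eqType) (leT : rel T).
Hypothesis leT_total : total leT.

(** One bottom-up pass merges neighbouring runs of length [w]; it is a relation because the
    recursion on [drop (w + w) l] is not structural. *)
Inductive pass (w : nat) : seq T -> seq T -> Prop :=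
| PassNil : pass w [::] [::]
| PassCons l l' : l != [::] -> pass w (drop (w + w) l) l' ->
    pass w l (merge leT (take w l) (take w (drop w l)) ++ l').

Inductive runs_sorted (w : nat) : seq T -> Prop :=
| RunsNil : runs_sorted w [::]
| RunsCons l : sorted leT (take w l) -> runs_sorted w (drop w l) ->
    runs_sorted w l.

Lemma runs_sorted1 l : runs_sorted 1 l.
Proof.
by elim: l => [|x l IH]; constructor; rewrite ?take0 //= ?take0 ?drop0.
Qed.

Lemma runs_sorted_all w l : (size l <= w)%N -> runs_sorted w l -> sorted leT l.
Proof. by move=> + runs; case: runs => // k srt _ le_w; rewrite take_oversize in srt. Qed.

Lemma pass_perm w l l' : pass w l l' -> perm_eq l' l.
Proof.
elim=> // {}l {}l' _ _ IH.
have {3}-> : l = (take w l ++ take w (drop w l)) ++ drop (w + w) l.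
  by rewrite -catA -drop_drop !cat_take_drop.
by rewrite perm_cat // perm_merge.
Qed.

Lemma pass_sorted w l l' : runs_sorted w l -> pass w l l' ->
  runs_sorted (w + w) l'.
Proof.
move=> + ps; elim: ps => {l l'} [|l l' l0 ps IH] runs; first by constructor.
have [srt1 srt2 runs2] : [/\ sorted leT (take w l),
    sorted leT (take w (drop w l)) & runs_sorted w (drop (w + w) l)].
  have nil_runs : runs_sorted w [::] by constructor.
  case: runs l0 => // {ps IH} k srt1 runs1 k0; split=> //.
    by case: runs1.
  by rewrite -drop_drop; case: runs1 => //=.
have srt := merge_sorted leT_total srt1 srt2.
(* Either the first merged run is full, or the list ends within it and the rest of the pass is
   empty. *)
have [szl|szl] := leqP (w + w) (size l).
  have sz : size (merge leT (take w l) (take w (drop w l))) = (w + w)%N.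
    rewrite size_merge size_cat !size_takel ?size_drop //; lia.
  by constructor; rewrite ?take_size_cat ?drop_size_cat //; exact: IH.
have -> : l' = [::].
  have := pass_perm ps; rewrite drop_oversize ?(ltnW szl) //.
  by move/perm_size/size0nil.
rewrite cats0; constructor.
  rewrite take_oversize // size_merge size_cat !size_take size_drop.
  by do 2!case: ifP; lia.
rewrite drop_oversize; first by constructor.
rewrite size_merge size_cat !size_take size_drop.
by do 2!case: ifP; lia.
Qed.
End MergeSort.

(** * Array segments *)

Section Slices.
Variable V : Type.
Implicit Types (a : nat -> V) (i j k : nat).

Definition slice a i j : seq V := [seq a x | x <- iota i (j - i)].

Lemma size_slice a i j : size (slice a i j) = (j - i)%N.
Proof. by rewrite size_map size_iota. Qed.

Lemma slice_nil a i j : (j <= i)%N -> slice a i j = [::].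
Proof. by rewrite /slice -subn_eq0 => /eqP ->. Qed.

Lemma slice_cons a i j : (i < j)%N -> slice a i j = a i :: slice a i.+1 j.
Proof. by move=> ij; rewrite /slice -subnSK. Qed.

Lemma nth_slice0 a j k x : (k < j)%N -> nth x (slice a 0 j) k = a k.
Proof. by move=> kj; rewrite /slice subn0 (nth_map 0%N) ?nth_iota ?size_iota. Qed.

Lemma slice0_rcons a j : slice a 0 j.+1 = rcons (slice a 0 j) (a j).
Proof. by rewrite /slice !subn0 -addn1 iotaD map_cat cats1. Qed.

Lemma eq_slice a b i j : (forall k, (i <= k < j)%N -> a k = b k) ->
  slice a i j = slice b i j.
Proof.
move=> E; apply/eq_in_map => k; rewrite mem_iota => /andP[ik kj].
by apply: E; rewrite ik; lia.
Qed.

Lemma slice_upd_rcons a j x : slice (upd a j x) 0 j.+1 = rcons (slice a 0 j) x.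
Proof.
rewrite slice0_rcons /= eqxx; congr rcons; apply: eq_slice => k kj.
by rewrite /upd ifF //; apply/eqP; lia.
Qed.

Lemma take_slice a w i j : take w (slice a i j) = slice a i (j - (j - (i + w))).
Proof.
rewrite /slice -map_take take_iota; congr map; congr iota.
by rewrite /minn; case: ltnP; lia.
Qed.

Lemma drop_slice a w i j : drop w (slice a i j) = slice a (i + w) j.
Proof. by rewrite /slice -map_drop drop_iota subnDA addnC. Qed.
End Slices.

(** * The merge sort program and its correctness *)

(** Scalars: 1 number of positive jobs, 2 run length, 3 loop counter, 4 and 6
    heads and 5 and 7 ends of the two runs being merged. *)
Definition incr c := IStore (ivA c) (IAdd (iv c) (IConst 1)).
Definition ltE a b := ILe (IAdd a (IConst 1)) b.

(** Truncated subtraction turns [N - (N - e)] into the minimum of [e] and [N]. *)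
Definition clip e := ISub (iv 1) (ISub (iv 1) e).

Definition next_runs :=
  If (ILe (iv 7) (iv 3))
    (Seq (IStore (ivA 4) (iv 7))
    (Seq (IStore (ivA 5) (clip (IAdd (iv 7) (iv 2))))
    (Seq (IStore (ivA 6) (iv 5))
         (IStore (ivA 7) (clip (IAdd (iv 5) (iv 2)))))))
    Skip.

Definition take_head c := Seq (IStore (bA (iv 3)) (arrAE (iv c))) (incr c).

Definition merge_step :=
  Seq (If (ltE (iv 4) (iv 5))
        (If (ltE (iv 6) (iv 7))
          (If (RLe (lenE (arrAE (iv 4))) (lenE (arrAE (iv 6))))
             (take_head 4) (take_head 6))
          (take_head 4))
        (take_head 6))
      (incr 3).

Definition merge_loop := While (ltE (iv 3) (iv 1)) (Seq next_runs merge_step).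

Definition copy_loop :=
  While (ltE (iv 3) (iv 1))
    (Seq (IStore (aA (iv 3)) (arrBE (iv 3))) (incr 3)).

Definition reset c := IStore (ivA c) (IConst 0).

Definition start_pass := Seq (reset 3) (Seq (reset 4) (Seq (reset 5)
  (Seq (reset 6) (reset 7)))).

Definition sort_pass :=
  Seq start_pass (Seq merge_loop (Seq (reset 3) (Seq copy_loop
    (IStore (ivA 2) (IAdd (iv 2) (iv 2)))))).

Definition sort_jobs :=
  Seq (IStore (ivA 2) (IConst 1)) (While (ltE (iv 2) (iv 1)) sort_pass).

Section SortJobs.
Local Open Scope nat_scope.
Variables (R : realFieldType) (n : nat).
Variables (r P : nat -> R) (o : nat -> nat) (q : nat -> R).

Definition by_len (i j : nat) := (P i <= P j)%R.

(** The part of [B] written so far, completed by the merge of the two current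
    runs and by any pass over the rest, is a pass over the whole of [A]. *)
Definition merging A w N (f B : nat -> nat) : Prop :=
  [/\ f 1 = N, f 2 = w, (f 3 <= f 7 <= N)%N &
  [/\ [&& f 4 <= f 5, f 5 <= f 6 & f 6 <= f 7]%N,
      (f 7 - f 3 = (f 5 - f 4) + (f 7 - f 6))%N &
      forall l, pass by_len w (slice A (f 7) N) l ->
        pass by_len w (slice A 0 N)
          (slice B 0 (f 3)
           ++ merge by_len (slice A (f 4) (f 5)) (slice A (f 6) (f 7)) ++ l)]].

Lemma next_runs_spec A w N f B : (0 < w)%N ->
  merging A w N f B -> (f 3 < N)%N ->
  exists f', [/\ run next_runs (conc n (Layout f A B r P o q))
                 = conc n (Layout f' A B r P o q),
    merging A w N f' B, f' 3 = f 3 & (f' 3 < f' 7)%N].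
Proof.
move=> w0 mrg ltN; rewrite run_if !evalE //; case: leqP => [le73|lt37]; last first.
  by rewrite run_skip; exists f; split.
case: mrg => f1 f2 le37 [le4567 eq7 inv].
rewrite !run_seq; do 8!rewrite ?runE ?evalE //=.
eexists; split; first by reflexivity.
- rewrite /merging /= f1 f2; split => //; first by lia.
  split; [by lia | by lia |] => l ps.
  (* The invariant is applied to the rest of the pass with the new pair merged in front. *)
  have := inv (merge by_len (take w (slice A (f 7) N))
                 (take w (drop w (slice A (f 7) N))) ++ l).
  rewrite (@slice_nil _ _ (f 4)); last by lia.
  rewrite (@slice_nil _ _ (f 6)); last by lia.
  move=> /= H; apply: {H}(eq_ind _ (fun x => pass by_len w _ (_ ++ x)) (H _) _ _).
    apply: PassCons; first by rewrite -size_eq0 size_slice; lia.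
    rewrite drop_slice; apply: (eq_ind _ (fun x => pass by_len w x l) ps).
    have [le_hi|lt_hi] := leqP (f 7 + (w + w)) N; first by congr slice; lia.
    by rewrite !slice_nil //; lia.
  congr (merge _ _ _ ++ _); first by rewrite take_slice.
  rewrite drop_slice take_slice.
  have [le_mid|lt_mid] := leqP (f 7 + w) N; first by congr slice; lia.
  by rewrite !slice_nil //; lia.
- by [].
- by rewrite /=; lia.
Qed.

Lemma merge_cons (T : Type) (leT : rel T) x y s1 s2 :
  merge leT (x :: s1) (y :: s2) =
  if leT x y then x :: merge leT s1 (y :: s2) else y :: merge leT (x :: s1) s2.
Proof. by []. Qed.

Lemma merge_step_spec A w N f B :
  merging A w N f B -> (f 3 < f 7)%N ->
  exists f' B', [/\ run merge_step (conc n (Layout f A B r P o q))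
                    = conc n (Layout f' A B' r P o q),
    merging A w N f' B' & f' 3 = (f 3).+1].
Proof.
case=> f1 f2 le37 [le4567 eq7 inv] lt37.
rewrite run_seq !run_if !evalE //.
have head4 : f 4 < f 5 ->
    merge by_len (slice A (f 4) (f 5)) (slice A (f 6) (f 7)) =
    A (f 4) :: merge by_len (slice A (f 4).+1 (f 5)) (slice A (f 6) (f 7)) ->
    exists f' B', [/\ run (incr 3) (run (take_head 4) (conc n (Layout f A B r P o q)))
                      = conc n (Layout f' A B' r P o q),
      merging A w N f' B' & f' 3 = (f 3).+1].
  move=> lt45 eq_merge; rewrite /take_head run_seq; do 4!rewrite ?runE ?evalE //=.
  do 2!eexists; split; first by reflexivity.
    rewrite /merging /= !addn1; split=> //; first by lia.
    split=> [||l ps]; try lia.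
    by rewrite slice_upd_rcons cat_rcons -cat_cons -eq_merge; exact: inv.
  by rewrite /= addn1.
have head6 : f 6 < f 7 ->
    merge by_len (slice A (f 4) (f 5)) (slice A (f 6) (f 7)) =
    A (f 6) :: merge by_len (slice A (f 4) (f 5)) (slice A (f 6).+1 (f 7)) ->
    exists f' B', [/\ run (incr 3) (run (take_head 6) (conc n (Layout f A B r P o q)))
                      = conc n (Layout f' A B' r P o q),
      merging A w N f' B' & f' 3 = (f 3).+1].
  move=> lt67 eq_merge; rewrite /take_head run_seq; do 4!rewrite ?runE ?evalE //=.
  do 2!eexists; split; first by reflexivity.
    rewrite /merging /= !addn1; split=> //; first by lia.
    split=> [||l ps]; try lia.
    by rewrite slice_upd_rcons cat_rcons -cat_cons -eq_merge; exact: inv.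
  by rewrite /= addn1.
rewrite !addn1; case: (ltnP (f 4) (f 5)) => [lt45|ge45]; last first.
  have lt67 : f 6 < f 7 by lia.
  by apply: head6 => //; rewrite slice_nil // (slice_cons _ lt67).
case: (ltnP (f 6) (f 7)) => [lt67|ge67]; last first.
  apply: head4 => //; rewrite (@slice_nil _ _ (f 6)) // (slice_cons _ lt45) /=.
  by case: (slice A (f 4).+1 (f 5)).
have := merge_cons by_len (A (f 4)) (A (f 6)) (slice A (f 4).+1 (f 5))
  (slice A (f 6).+1 (f 7)).
rewrite -(slice_cons _ lt45) -(slice_cons _ lt67).
rewrite [in X in _ = X -> _](_ : by_len (A (f 4)) (A (f 6)) = (P (A (f 4)) <= P (A (f 6)))%R) //.
by case: (P (A (f 4)) <= P (A (f 6)))%R => eq_merge; [exact: head4 | exact: head6].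
Qed.

Lemma merge_loop_spec f A B w N : (0 < w)%N -> merging A w N f B -> f 3 = 0%N ->
  reach merge_loop (conc n (Layout f A B r P o q))
    (N * (bcost (ltE (iv 3) (iv 1)) + wcost (Seq next_runs merge_step))
     + bcost (ltE (iv 3) (iv 1)))
    (fun st => exists f' B', [/\ st = conc n (Layout f' A B' r P o q),
       f' 1 = N, f' 2 = w & pass by_len w (slice A 0 N) (slice B' 0 N)]).
Proof.
move=> w0 mrg f3.
pose I m st := exists f B, [/\ st = conc n (Layout f A B r P o q),
  m = (N - f 3)%N & merging A w N f B].
apply: reach_weaken (leqnn _) _ (@reach_while R I _ _
  (wcost (Seq next_runs merge_step)) N _ _ _); last first.
- by exists f, B; rewrite f3 subn0.
- move=> m _ [g [C [-> -> mrg']]].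
  have [g1 _ _ _] := mrg'; rewrite !evalE // g1 addn1 => lt_k.
  apply: reach_run => //; rewrite run_seq.
  have [g' [-> mrg2 g3 lt37]] := next_runs_spec w0 mrg' lt_k.
  have [g'' [C' [-> mrg3 g3']]] := merge_step_spec mrg2 lt37.
  exists (N - g'' 3)%N; first by rewrite g3' g3; lia.
  by exists g'', C'.
move=> st [+ [m [g [C [E _ [g1 g2 le37 [le4567 eq7 inv]]]]]]]; subst st.
rewrite !evalE // => lt_k; exists g, C; split=> //.
have := inv [::]; rewrite cats0.
rewrite (@slice_nil _ _ (g 7)); last by lia.
rewrite (@slice_nil _ _ (g 4)); last by lia.
rewrite (@slice_nil _ _ (g 6)); last by lia.
have -> : g 3 = N by lia.
by rewrite cats0; apply; constructor.
Qed.

Lemma copy_loop_spec f A B N : f 1 = N -> f 3 = 0 ->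
  reach copy_loop (conc n (Layout f A B r P o q))
    (N * (bcost (ltE (iv 3) (iv 1))
          + wcost (Seq (IStore (aA (iv 3)) (arrBE (iv 3))) (incr 3)))
     + bcost (ltE (iv 3) (iv 1)))
    (fun st => exists f' A', [/\ st = conc n (Layout f' A' B r P o q),
       f' 1 = N, f' 2 = f 2 & slice A' 0 N = slice B 0 N]).
Proof.
move=> f1 f3.
pose I m st := exists g C, [/\ st = conc n (Layout g C B r P o q),
  m = N - g 3, [/\ g 1 = N, g 2 = f 2 & g 3 <= N] &
  forall x, x < g 3 -> C x = B x].
apply: reach_weaken (leqnn _) _ (@reach_while R I _ _
  (wcost (Seq (IStore (aA (iv 3)) (arrBE (iv 3))) (incr 3))) N _ _ _); last first.
- by exists f, A; rewrite f3 subn0; split.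
- move=> m _ [g [C [-> -> [g1 g2 g3] eqC]]].
  rewrite !evalE // g1 addn1 => lt_k.
  apply: reach_run => //; rewrite run_seq; do 2!rewrite ?runE ?evalE //=.
  exists (N - (g 3).+1); first by lia.
  do 2!eexists; split; first by reflexivity.
  + by rewrite /= addn1.
  + by rewrite /= addn1 g1 g2.
  + move=> x; rewrite /= addn1 ltnS leq_eqVlt => /predU1P[->|lt_x].
      by rewrite eqxx.
    by rewrite ifF ?eqC //; apply/eqP; lia.
move=> st [+ [m [g [C [E _ [g1 g2 g3] eqC]]]]]; subst st.
rewrite !evalE // => lt_k; exists g, C; split=> //.
by apply: eq_slice => x xN; apply: eqC; lia.
Qed.

Definition pass_cost N : nat :=
  wcost start_pass +
  (N * (bcost (ltE (iv 3) (iv 1)) + wcost (Seq next_runs merge_step))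
   + bcost (ltE (iv 3) (iv 1)) +
  (wcost (reset 3) +
  (N * (bcost (ltE (iv 3) (iv 1))
        + wcost (Seq (IStore (aA (iv 3)) (arrBE (iv 3))) (incr 3)))
   + bcost (ltE (iv 3) (iv 1)) +
   wcost (IStore (ivA 2) (IAdd (iv 2) (iv 2)))))).

Lemma sort_pass_spec f A B w N : 0 < w -> f 1 = N -> f 2 = w ->
  reach sort_pass (conc n (Layout f A B r P o q)) (pass_cost N)
    (fun st => exists f' A' B', [/\ st = conc n (Layout f' A' B' r P o q),
       f' 1 = N, f' 2 = w + w & pass by_len w (slice A 0 N) (slice A' 0 N)]).
Proof.
move=> w0 f1 f2; apply: reach_seq.
  apply: (@reach_run _ _ _ (fun st => exists f',
    [/\ st = conc n (Layout f' A B r P o q), f' 3 = 0 & merging A w N f' B])) => //.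
  rewrite /start_pass /reset !run_seq; do 6!rewrite ?runE ?evalE //=.
  eexists; split; first by reflexivity.
    by [].
  by rewrite /merging /=; split=> //; rewrite slice_nil.
move=> _ [g [-> g3 mrg]].
apply: reach_seq; first exact: merge_loop_spec w0 mrg g3.
move=> _ [h [C [-> h1 h2 ps]]].
apply: reach_seq.
  apply: (@reach_run _ _ _ (fun st => exists f',
    [/\ st = conc n (Layout f' A C r P o q), f' 1 = N, f' 2 = w & f' 3 = 0])) => //.
  rewrite /reset; do 2!rewrite ?runE ?evalE //=.
  by eexists; split; first by reflexivity.
move=> _ [h' [-> h1' h2' h3']].
apply: reach_seq; first exact: copy_loop_spec h1' h3'.
move=> _ [f' [D [-> f1' f2' eqD]]].
apply: reach_run => //; do 3!rewrite ?runE ?evalE //=.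
do 3!eexists; split; first by reflexivity.
- by [].
- by rewrite /= f2' h2'.
- by rewrite eqD.
Qed.

(** The run length [w] doubles in each pass while [N <= 2 ^ m * w] is kept with [m] dropping by one,
    so [k] passes suffice. *)
Lemma sort_jobs_spec f A B N k : f 1 = N -> N <= 2 ^ k ->
  reach sort_jobs (conc n (Layout f A B r P o q))
    (wcost (IStore (ivA 2) (IConst 1))
     + (k * (bcost (ltE (iv 2) (iv 1)) + pass_cost N)
        + bcost (ltE (iv 2) (iv 1))))
    (fun st => exists f' A' B', [/\ st = conc n (Layout f' A' B' r P o q),
       f' 1 = N, perm_eq (slice A' 0 N) (slice A 0 N)
       & sorted by_len (slice A' 0 N)]).
Proof.
move=> f1 leN; have by_len_total : total by_len by move=> i j; exact: le_total.
apply: reach_seq.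
  apply: (@reach_run _ _ _ (fun st => exists f',
    [/\ st = conc n (Layout f' A B r P o q), f' 1 = N & f' 2 = 1])) => //.
  do 2!rewrite ?runE ?evalE //=.
  by eexists; split; first by reflexivity.
move=> _ [g [-> g1 g2]].
pose I m st := exists f' A' B' w, [/\ st = conc n (Layout f' A' B' r P o q),
  f' 1 = N /\ f' 2 = w, 0 < w /\ N <= 2 ^ m * w,
  perm_eq (slice A' 0 N) (slice A 0 N) & runs_sorted by_len w (slice A' 0 N)].
apply: reach_weaken (leqnn _) _ (@reach_while R I _ _ (pass_cost N) k _ _ _);
  last first.
- by exists g, A, B, 1; split=> //; [rewrite muln1 | exact: runs_sorted1].
- move=> m _ [h [C [D [w [-> [h1 h2] [w0 {}leN] prm runs]]]]].
  rewrite !evalE // h1 h2 addn1 => lt_w.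
  have m0 : 0 < m by case: m leN => // leN; lia.
  apply: reach_weaken (leqnn _) _ (sort_pass_spec C D w0 h1 h2).
  move=> _ [f' [A' [B' [-> f1' f2' ps]]]].
  exists m.-1; first by rewrite prednK.
  exists f', A', B', (w + w); split=> //.
  + split; first by rewrite addn_gt0 w0.
    by rewrite -{1}(prednK m0) expnS in leN; lia.
  + exact: perm_trans (pass_perm ps) prm.
  + exact: pass_sorted runs ps.
move=> st [+ [m [h [C [D [w [E [h1 h2] [w0 _] prm runs]]]]]]]; subst st.
rewrite !evalE // h1 h2 => lt_w; exists h, C, D; split=> //.
by apply: runs_sorted_all runs; rewrite size_slice; lia.
Qed.
End SortJobs.

(** * The scheduling program *)

(** Further scalars: 0 input counter, 8 number of whole jobs, 9 number of
    parts, 10 the machine that is free first, 11 and 12 job and machine of the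
    next part; reals: 0 setup time, 1 setup time times the number of jobs left,
    2 gap, 3 gain, 4 best gain, 5 and 6 loads, 7 balanced load, 8 processing
    time, 9 and 10 setup start and length of the next part. *)
Definition read_job :=
  Seq (RStore (lenA (iv 0)) (RLoad (IAdd (IConst 1) (iv 0))))
  (Seq (If (RLe (lenE (iv 0)) RZero) Skip
          (Seq (IStore (aA (iv 1)) (iv 0))
          (Seq (incr 1) (RStore (rvA 1) (RAdd (rv 1) (rv 0))))))
       (incr 0)).

Definition read_loop := While (ltE (iv 0) nE) read_job.

Definition scan_start :=
  Seq (reset 3) (Seq (reset 8) (Seq (RStore (rvA 2) RZero)
    (Seq (RStore (rvA 3) RZero) (RStore (rvA 4) RZero)))).

(** At index [k] real scalar 1 holds [(N - k) * s], the setup term of [gain]. The nonstrict test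
    prefers the later index on ties, which yields the largest minimiser. *)
Definition scan_job :=
  Seq (RStore (rvA 2) (RSub (RAdd (lenE (arrAE (iv 3))) (rv 0)) (rv 2)))
  (Seq (RStore (rvA 3) (RSub (RAdd (rv 3) (rv 2)) (rv 1)))
  (Seq (RStore (rvA 1) (RSub (rv 1) (rv 0)))
  (Seq (incr 3)
       (If (RLe (rv 3) (rv 4))
          (Seq (RStore (rvA 4) (rv 3)) (IStore (ivA 8) (iv 3))) Skip)))).

Definition scan_loop := While (ltE (iv 3) (iv 1)) scan_job.

Definition cell2 k := IAdd (IAdd (iv 9) (iv 9)) (IConst k).
Definition cell3 k := IAdd (IAdd (iv 9) (IAdd (iv 9) (iv 9))) (IConst k).

Definition emit :=
  Seq (IStore (cell2 1) (iv 11))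
  (Seq (IStore (cell2 2) (iv 12))
  (Seq (RStore (cell3 0) (rv 9))
  (Seq (RStore (cell3 1) (RAdd (rv 9) (rv 0)))
  (Seq (RStore (cell3 2) (rv 10))
       (incr 9))))).

Definition put mE sE lE :=
  Seq (IStore (ivA 12) mE) (Seq (RStore (rvA 9) sE) (Seq (RStore (rvA 10) lE) emit)).

Definition put_whole :=
  Seq (put (iv 10) (rv 5) (rv 8))
  (Seq (RStore (rvA 7) (RAdd (RAdd (rv 5) (rv 0)) (rv 8)))
  (Seq (RStore (rvA 5) (rv 6))
  (Seq (RStore (rvA 6) (rv 7))
       (IStore (ivA 10) (ISub (IConst 1) (iv 10)))))).

Definition put_split :=
  Seq (RStore (rvA 7)
         (RDiv (RAdd (RAdd (RAdd (RAdd (rv 5) (rv 6)) (rv 8)) (rv 0)) (rv 0))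
               (RAdd ROne ROne)))
  (Seq (put (iv 10) (rv 5) (RSub (RSub (rv 7) (rv 5)) (rv 0)))
  (Seq (put (ISub (IConst 1) (iv 10)) (rv 6) (RSub (RSub (rv 7) (rv 6)) (rv 0)))
  (Seq (RStore (rvA 5) (rv 7))
       (RStore (rvA 6) (rv 7))))).

Definition write_start :=
  Seq (reset 3) (Seq (reset 9) (Seq (reset 10)
    (Seq (RStore (rvA 5) RZero) (RStore (rvA 6) RZero)))).

Definition write_job :=
  Seq (IStore (ivA 11) (arrAE (iv 3)))
  (Seq (RStore (rvA 8) (lenE (iv 11)))
  (Seq (If (ltE (iv 3) (iv 8)) put_whole put_split)
       (incr 3))).

Definition write_loop := While (ltE (iv 3) (iv 1)) write_job.

(** The setup time and the lengths are copied first because the output overwrites the input cells.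
    Integer cell 0 is overwritten last because the computed addresses depend on [n]. *)
Definition scheduler :=
  Seq (RStore (rvA 0) (RLoad (IConst 0)))
  (Seq read_loop
  (Seq sort_jobs
  (Seq scan_start
  (Seq scan_loop
  (Seq write_start
  (Seq write_loop
       (IStore (IConst 0) (iv 9)))))))).

(** * Correctness of the loops of the scheduler *)

Section Scheduler.
Local Open Scope nat_scope.
Variables (R : realFieldType) (n : nat).
Implicit Types (f A B : nat -> nat) (r P q : nat -> R) (o : nat -> nat) (s : R).

(** Integers are never converted to reals, so the product of [s] and the number of positive jobs is
    accumulated by addition. *)
Lemma read_loop_spec f A B r P o q s key :
  f 0 = 0 -> f 1 = 0 -> r 0 = s -> r 1 = 0%R ->
  (forall x, x < n -> q x.+1 = key x) ->
  let L := [seq x <- iota 0 n | 0 < key x]%R in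
  reach read_loop (conc n (Layout f A B r P o q))
    (n * (bcost (ltE (iv 0) nE) + wcost read_job) + bcost (ltE (iv 0) nE))
    (fun st : state R => exists f' A' r' P',
      [/\ st = conc n (Layout f' A' B r' P' o q),
          f' 1 = size L, slice A' 0 (size L) = L,
          r' 0 = s /\ r' 1 = ((size L)%:R * s)%R
        & forall x, x < n -> P' x = key x]).
Proof.
move=> f0 f1 r0 r1 eq_q /=.
pose L k := [seq x <- iota 0 k | 0 < key x]%R.
pose I m st := exists f' A' r' P' k, [/\ st = conc n (Layout f' A' B r' P' o q),
    [/\ m = n - k, k <= n & f' 0 = k],
    f' 1 = size (L k) /\ slice A' 0 (size (L k)) = L k,
    r' 0 = s /\ r' 1 = ((size (L k))%:R * s)%R
  & forall x, x < k -> P' x = key x].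
apply: reach_weaken (leqnn _) _ (@reach_while R I _ _ (wcost read_job) n _ _ _);
  last first.
- exists f, A, r, P, 0; split=> //; first by rewrite subn0.
  by rewrite mul0r.
- move=> m _ [h [C [u [S [k [-> [-> kn fk] [fN AL] [u0 u1] eqS]]]]]].
  rewrite !evalE // fk addn1 => lt_k.
  apply: reach_run => //.
  have LS : L k.+1 = if (0 < key k)%R then rcons (L k) k else L k.
    by rewrite /L -addn1 iotaD filter_cat /= add0n; case: ifP; rewrite ?cats1 ?cats0.
  rewrite run_seq run_len !reval_rout; last by rewrite !evalE // fk; lia.
  rewrite run_seq run_if; do 4!rewrite ?run_seq ?runE ?evalE //=.
  rewrite fk add1n eq_q // eqxx.
  case: (lerP (key k) 0) LS => [le_k|gt_k] LS.
    rewrite run_skip; do 2!rewrite ?runE ?evalE //=.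
    exists (n - k.+1); first by lia.
    do 4!eexists; exists k.+1; split; first by reflexivity.
    + by rewrite /= fk addn1.
    + by rewrite LS.
    + by rewrite LS.
    + move=> x; rewrite /= ltnS leq_eqVlt => /predU1P[->|lt_x].
        by rewrite eqxx.
      by rewrite ifF ?eqS //; apply/eqP; lia.
  do 4!rewrite ?run_seq ?runE ?evalE //=.
  exists (n - k.+1); first by lia.
  do 4!eexists; exists k.+1; split; first by reflexivity.
  + by rewrite /= fk addn1.
  + by rewrite LS /= size_rcons fN addn1 slice_upd_rcons AL.
  + by rewrite LS /= size_rcons u0 u1 -natr1 mulrDl mul1r.
  + move=> x; rewrite /= ltnS leq_eqVlt => /predU1P[->|lt_x].
      by rewrite eqxx.
    by rewrite ifF ?eqS //; apply/eqP; lia.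
move=> st [+ [m [g [C [u [S [k [E [_ kn gk] [gN AL] u01 eqS]]]]]]]]; subst st.
rewrite !evalE // gk => le_k.
have En : k = n by lia.
by subst k; exists g, C, u, S; split; rewrite -?En.
Qed.

Lemma scan_loop_spec f A B r P o q s N : (0 < s)%R ->
  let ps := [seq P x | x <- slice A 0 N] in
  f 1 = N -> f 3 = 0 -> f 8 = 0 -> r 0 = s -> r 1 = (N%:R * s)%R ->
  r 2 = 0%R -> r 3 = 0%R -> r 4 = 0%R ->
  reach scan_loop (conc n (Layout f A B r P o q))
    (N * (bcost (ltE (iv 3) (iv 1)) + wcost scan_job) + bcost (ltE (iv 3) (iv 1)))
    (fun st : state R => exists f' r',
      [/\ st = conc n (Layout f' A B r' P o q),
          f' 1 = N, best_prefix s ps (f' 8) & r' 0 = s]).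
Proof.
move=> s0 ps f1 f3 f8 r0 r1 r2 r3 r4.
have szps : size ps = N by rewrite size_map size_slice subn0.
have nth_ps k : k < N -> (ps`_k)%R = P (A k).
  by move=> kN; rewrite (nth_map 0) ?size_slice ?subn0 // nth_slice0.
pose I m st := exists g u k, [/\ st = conc n (Layout g A B u P o q),
    [/\ m = N - k, k <= N & g 3 = k],
    [/\ g 1 = N, u 0 = s & u 1 = ((N - k)%:R * s)%R],
    [/\ u 2 = gap s ps k, u 3 = gain s ps k & u 4 = gain s ps (g 8)]
  & g 8 <= k /\ forall t, t <= k -> (gain s ps (g 8%N) <= gain s ps t)%R /\
      (g 8 < t -> (gain s ps (g 8%N) < gain s ps t)%R)].
apply: reach_weaken (leqnn _) _ (@reach_while R I _ _ (wcost scan_job) N _ _ _);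
  last first.
- exists f, r, 0; split; rewrite ?f8 ?subn0 //; split=> // t.
  by rewrite leqn0 => /eqP ->.
- move=> m _ [g [u [k [-> [-> kN gk] [g1 u0 u1] [u2 u3 u4] [le8 best]]]]].
  rewrite !evalE // gk g1 addn1 => lt_k.
  apply: reach_run => //; rewrite /scan_job !run_seq run_if.
  do 6!rewrite ?run_seq ?runE ?evalE //=.
  rewrite gk u0 u1 u2 u3 u4 addn1.
  have gapE : (P (A k) + s - gap s ps k)%R = gap s ps k.+1 by rewrite /= nth_ps.
  have gainE : (gain s ps k + gap s ps k.+1 - (N - k)%:R * s)%R = gain s ps k.+1.
    by rewrite [RHS]/= szps.
  have wE : ((N - k)%:R * s - s)%R = ((N - k.+1)%:R * s)%R.
    by rewrite -subnSK // -natr1 mulrDl mul1r addrK.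
  rewrite gapE gainE wE.
  exists (N - k.+1); first by lia.
  case: (lerP (gain s ps k.+1) (gain s ps (g 8%N))) => [le_g|gt_g].
    rewrite ?run_seq; do 3!rewrite ?runE ?evalE //=.
    do 2!eexists; exists k.+1; split; first by reflexivity.
    + by split.
    + by split.
    + by split; rewrite //= gk addn1.
    + rewrite /= ?gk ?addn1; split=> // t; rewrite leq_eqVlt => /predU1P[->|].
        by rewrite lexx ltnn.
      rewrite ltnS => le_t; have [le_b _] := best t le_t.
      by split; [exact: le_trans le_g le_b | rewrite ltnNge ltnW].
  rewrite run_skip; do 2!eexists; exists k.+1; split; first by reflexivity.
  + by split.
  + by split.
  + by split.
  + rewrite /=; split=> [|t]; first exact: leqW.
    rewrite leq_eqVlt => /predU1P[->|]; first by split=> //; exact: ltW.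
    by rewrite ltnS; exact: best.
move=> st [+ [m [g [u [k [E [_ kN gk] [g1 u0 _] _ best]]]]]]; subst st.
rewrite !evalE // gk g1 => le_k; have En : k = N by lia.
by exists g, u; split=> //; rewrite /best_prefix szps -En.
Qed.

(** The tuples that [output] reads; the count [c] is separate because integer cell 0 still holds
    [n]. *)
Definition decode (o : nat -> nat) (q : nat -> R) (c : nat) :=
  [seq (o (2 * i + 1), o (2 * i + 2), q (3 * i), q (3 * i + 1), q (3 * i + 2))
  | i <- iota 0 c].

Lemma put_spec mE sE lE f A B r P o q c mv sv lv :
  f 9 = c -> c < 2 * n ->
  ieval (conc n (Layout f A B r P o q)) mE = mv ->
  reval (conc n (Layout (upd f 12 mv) A B r P o q)) sE = sv ->
  reval (conc n (Layout (upd f 12 mv) A B (upd r 9 sv) P o q)) lE = lv ->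
  exists o' q',
    run (put mE sE lE) (conc n (Layout f A B r P o q))
    = conc n (Layout (upd (upd f 12 mv) 9 c.+1) A B (upd (upd r 9 sv) 10 lv) P o' q')
    /\ decode o' q' c.+1
       = rcons (decode o q c) (f 11, mv, sv, (sv + r 0)%R, lv).
Proof.
move=> fc c_lt mvE svE lvE.
rewrite /put /emit !run_seq run_scalar // mvE run_rscalar // svE run_rscalar // lvE.
set f' := upd f 12 mv; set r' := upd (upd r 9 sv) 10 lv.
have c2 k A' B' P' o' q' :
    ieval (conc n (Layout f' A' B' r' P' o' q')) (cell2 k) = 2 * c + k.
  by rewrite !evalE // /f' /= fc; lia.
have c3 k A' B' P' o' q' :
    ieval (conc n (Layout f' A' B' r' P' o' q')) (cell3 k) = 3 * c + k.
  by rewrite !evalE // /f' /= fc; lia.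
rewrite run_iout c2; last by lia.
rewrite run_iout c2; last by lia.
rewrite run_rout c3; last by lia.
rewrite run_rout c3; last by lia.
rewrite run_rout c3; last by lia.
do 2!rewrite ?runE ?evalE //=.
have -> : f' 9 = c by rewrite /f' /= fc.
rewrite addn1 /f' /r' /=; do 2!eexists; split; first by reflexivity.
rewrite /decode -(addn1 c) iotaD map_cat cats1; congr rcons.
  apply/eq_in_map => i; rewrite mem_iota => /andP[_ lt_i] /=.
  by rewrite !ifF //; apply/eqP; lia.
rewrite add0n /= !addn0 !eqxx.
by rewrite !ifF //; apply/eqP; lia.
Qed.
Definition encode (a : part R 2 n) :=
  (nat_of_ord (pjob a), nat_of_ord (pmach a), psetup a, pstart a, plen a).

Lemma val_mach (h : bool) : nat_of_ord (mach h) = h.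
Proof. by case: h. Qed.

(** Invariant: the parts written, followed by those that [build] makes of the remaining jobs, form
    the whole schedule. The truncated [m - k] is 0 once the splitting has begun. *)
Lemma write_loop_spec f A B r P o q s N m (p : 'I_n -> R) (js : seq 'I_n) :
  [seq nat_of_ord j | j <- js] = slice A 0 N -> (forall j, P (nat_of_ord j) = p j) ->
  N <= n -> f 1 = N -> f 8 = m -> f 3 = 0 -> f 9 = 0 -> f 10 = 0 ->
  r 0 = s -> r 5 = 0%R -> r 6 = 0%R ->
  reach write_loop (conc n (Layout f A B r P o q))
    (N * (bcost (ltE (iv 3) (iv 1)) + wcost write_job) + bcost (ltE (iv 3) (iv 1)))
    (fun st : state R => exists f' r' o' q',
      [/\ st = conc n (Layout f' A B r' P o' q'), f' 9 <= 2 * n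
        & decode o' q' (f' 9) = [seq encode a | a <- build s p m 0 0 false js]]).
Proof.
move=> js_A Pp Nn f1 f8 f3 f9 f10 r0 r5 r6.
have szjs : size js = N.
  by have := congr1 size js_A; rewrite size_map size_slice subn0.
pose I t st := exists g u o' q' k (h : bool),
  [/\ st = conc n (Layout g A B u P o' q'),
    [/\ t = N - k, k <= N & g 3 = k],
    [/\ g 1 = N, g 8 = m & u 0 = s],
    g 10 = h /\ g 9 <= 2 * k
  & decode o' q' (g 9) ++
      [seq encode a | a <- build s p (m - k) (u 5) (u 6) h (drop k js)]
    = [seq encode a | a <- build s p m 0 0 false js]].
apply: reach_weaken (leqnn _) _ (@reach_while R I _ _ (wcost write_job) N _ _ _);
  last first.
- exists f, r, o, q, 0, false; split; rewrite ?subn0 ?f9 //.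
  by rewrite drop0 r5 r6.
- move=> t _ [g [u [o' [q' [k [h [-> [-> kN gk] [g1 g8 u0] [g10 g9] eq_dec]]]]]]].
  rewrite !evalE // gk g1 addn1 => lt_k.
  apply: reach_run => //; rewrite /write_job !run_seq run_if.
  do 4!rewrite ?runE ?evalE //=.
  rewrite gk g8 addn1.
  have k_js : k < size js by rewrite szjs.
  case Ejs: (drop k js) => [|j js'].
    by have := congr1 size Ejs; rewrite size_drop /= szjs; lia.
  have js'E : js' = drop k.+1 js by rewrite -[k.+1]add1n -drop_drop Ejs /= drop0.
  have jE : A k = nat_of_ord j.
    rewrite -(nth_slice0 A 0 lt_k) -js_A (nth_map j) //.
    by rewrite -[k in nth _ _ k]addn0 -nth_drop Ejs.
  rewrite jE Pp; exists (N - k.+1); first by lia.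
  set g1' := upd g 11 _; set u1 := upd u 8 _.
  have g9' : g1' 9 = g 9 by [].
  case: (ltnP k m) => [lt_m|ge_m].
    rewrite /put_whole 4!run_seq.
    have [o1 [q1 [-> dec1]]] := @put_spec (iv 10) (rv 5) (rv 8) g1' A B u1 P o' q'
      (g 9) h (u 5) (p j) g9' (ltac:(lia)) (ltac:(by rewrite !evalE))
      (ltac:(by rewrite !evalE)) (ltac:(by rewrite !evalE)).
    do 6!rewrite ?runE ?evalE //=.
    rewrite /g1' /u1 /= gk addn1.
    do 4!eexists; exists k.+1, (~~ h); split; first by reflexivity.
    + by [].
    + by [].
    + by rewrite /= g10; case: (h); split; lia.
    + rewrite [upd _ _ _ 9]/= dec1 -js'E -eq_dec Ejs -(subnSK lt_m) /=.
      by rewrite cat_rcons /encode /= val_mach /g1' /u1 /= u0.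
  rewrite /put_split 4!run_seq run_rscalar //.
  set T := reval _ _; set u2 := upd u1 7 T.
  have TE : T = ((u 5 + u 6 + p j + s + s) / 2)%R by rewrite /T !evalE // /u1 /= u0.
  have [o1 [q1 [-> dec1]]] := @put_spec (iv 10) (rv 5)
    (RSub (RSub (rv 7) (rv 5)) (rv 0)) g1' A B u2 P o' q'
    (g 9) h (u 5) (T - u 5 - s)%R g9' (ltac:(lia)) (ltac:(by rewrite !evalE))
    (ltac:(by rewrite !evalE)) (ltac:(by rewrite !evalE // /u2 /u1 /= u0)).
  set g2 := upd (upd g1' _ _) _ _; set u3 := upd (upd u2 _ _) _ _.
  have [o2 [q2 [-> dec2]]] := @put_spec (ISub (IConst 1) (iv 10)) (rv 6)
    (RSub (RSub (rv 7) (rv 6)) (rv 0)) g2 A B u3 P o1 q1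
    (g 9).+1 (~~ h) (u 6) (T - u 6 - s)%R (erefl _) (ltac:(lia))
    (ltac:(by rewrite !evalE // /g2 /g1' /= g10; case: (h)))
    (ltac:(by rewrite !evalE)) (ltac:(by rewrite !evalE // /u3 /u2 /u1 /= u0)).
  do 6!rewrite ?runE ?evalE //=.
  rewrite /g2 /u3 /u2 /g1' /u1 /= gk addn1.
  do 4!eexists; exists k.+1, h; split; first by reflexivity.
  + by [].
  + by [].
  + by rewrite /= g10; split; lia.
  + rewrite [upd _ _ _ 9]/= dec2 dec1 -js'E -eq_dec Ejs.
    have -> : m - k = 0 by lia.
    have -> : m - k.+1 = 0 by lia.
    by rewrite /= !cat_rcons /encode /= !val_mach /g2 /u3 /u2 /g1' /u1 /= u0 -TE.
move=> st [+ [t [g [u [o' [q' [k [h [E [_ kN gk] [g1 _ _] [_ g9] eq_dec]]]]]]]]].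
subst st; rewrite !evalE // gk g1 => le_k; have Ek : k = N by lia.
exists g, u, o', q'; split=> //; first by lia.
by rewrite -eq_dec drop_oversize ?cats0 // szjs Ek.
Qed.
End Scheduler.

(** * Running time *)

Definition loop_cost k b c := (k * (bcost b + wcost c) + bcost b)%N.

Definition scheduler_time n : nat :=
  wcost (RStore (rvA 0) (RLoad (IConst 0))) +
  (loop_cost n (ltE (iv 0) nE) read_job +
  (wcost (IStore (ivA 2) (IConst 1)) +
   ((trunc_log 2 n).+1 * (bcost (ltE (iv 2) (iv 1)) + pass_cost n)
    + bcost (ltE (iv 2) (iv 1))) +
  (wcost scan_start +
  (loop_cost n (ltE (iv 3) (iv 1)) scan_job +
  (wcost write_start +
  (loop_cost n (ltE (iv 3) (iv 1)) write_job +
   wcost (IStore (IConst 0) (iv 9)))))))).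

Definition linearithmic (T : nat -> nat) :=
  exists c, forall n, (2 <= n)%N -> (T n <= c * (n * trunc_log 2 n))%N.

Lemma linearithmicD T1 T2 : linearithmic T1 -> linearithmic T2 ->
  linearithmic (fun n => T1 n + T2 n)%N.
Proof.
move=> [c1 le1] [c2 le2]; exists (c1 + c2)%N => n n2.
by rewrite mulnDl leq_add ?le1 ?le2.
Qed.

Lemma linearithmic_const a : linearithmic (fun=> a).
Proof.
exists a => n n2; rewrite leq_pmulr // muln_gt0 trunc_log_gt0 //= n2 andbT.
exact: ltnW.
Qed.

Lemma linearithmic_lin a : linearithmic (fun n => n * a)%N.
Proof.
by exists a => n n2; rewrite mulnC leq_mul2l leq_pmulr ?orbT // trunc_log_gt0.
Qed.

Lemma linearithmic_log a b :
  linearithmic (fun n => (trunc_log 2 n).+1 * (a + n * b))%N.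
Proof.
exists (2 * (a + b))%N => n n2.
have l1 : (0 < trunc_log 2 n)%N by rewrite trunc_log_gt0.
rewrite (mulnC n (trunc_log 2 n)) mulnACA; apply: leq_mul; first by lia.
by rewrite mulnDl (mulnC n b) leq_add2r leq_pmulr // ltnW.
Qed.

Lemma pass_cost_linear : exists a b, forall n, pass_cost n = (a + n * b)%N.
Proof.
rewrite /pass_cost; set b := bcost _; set a1 := wcost start_pass.
set a2 := wcost (Seq next_runs merge_step); set a3 := wcost (reset 3).
set a4 := wcost (Seq (IStore (aA _) _) _); set a5 := wcost (IStore _ _).
exists (a1 + b + a3 + b + a5)%N, (b + a2 + (b + a4))%N => n.
by rewrite !mulnDr; lia.
Qed.

Lemma scheduler_time_linearithmic : linearithmic scheduler_time.
Proof.
have [a [b passE]] := pass_cost_linear.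
have sortL : linearithmic (fun n =>
    (trunc_log 2 n).+1 * (bcost (ltE (iv 2) (iv 1)) + pass_cost n))%N.
  have [c le_c] := linearithmic_log (bcost (ltE (iv 2) (iv 1)) + a) b.
  by exists c => n n2; rewrite passE addnA le_c.
have loopL t c : linearithmic (fun n => loop_cost n t c).
  by apply: linearithmicD (linearithmic_lin _) (linearithmic_const _).
rewrite /scheduler_time.
by do ![exact: linearithmic_const | exact: loopL | exact: sortL
       | apply: linearithmicD].
Qed.

(** * Total correctness of the program *)

Lemma ord_seq n (l : seq nat) : all (fun x => x < n)%N l ->
  exists js : seq 'I_n, [seq nat_of_ord j | j <- js] = l.
Proof.
elim: l => [_|x l IH /= /andP[x_lt /IH[js <-]]]; first by exists [::].
by exists (Ordinal x_lt :: js).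
Qed.

Lemma pass_cost_mono N n : (N <= n)%N -> (pass_cost N <= pass_cost n)%N.
Proof. by move=> le_N; rewrite /pass_cost !(leq_add2l, leq_add2r, leq_add) // leq_mul. Qed.

Lemma scheduler_spec (R : realFieldType) n (s : R) (p : 'I_n -> R) :
  0 < s -> (forall j, 0 <= p j) ->
  reach scheduler (input s p) (scheduler_time n)
    (fun st => exists S : schedule R 2 n, output st S /\ optimal s p S).
Proof.
move=> s0 p0; pose key x := nth 0 [seq p j | j <- enum 'I_n] x.
have keyE (j : 'I_n) : key (nat_of_ord j) = p j.
  by rewrite /key (nth_map j) ?size_enum_ord // nth_ord_enum.
pose q := nth 0 (s :: [seq p j | j <- enum 'I_n]).
pose z := fun _ : nat => 0%N; pose y := fun _ : nat => 0 : R.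
have -> : input s p = conc n (Layout z z z y y z q).
  apply: state_eq => x; rewrite /input /conc /=.
    by case: x => [|x] //=; rewrite nth_nil /z !if_same.
  case: (leqP x (6 * n)) => // lt_x.
  rewrite nth_default; first by rewrite /y if_same.
  by rewrite /= size_map size_enum_ord; lia.
apply: reach_seq.
  apply: (@reach_run _ _ _ (fun st => exists r,
    [/\ st = conc n (Layout z z z r y z q), r 0%N = s & r 1%N = 0])) => //.
  rewrite run_rscalar // reval_rout //; eexists; split; first by reflexivity.
    by [].
  by [].
move=> _ [r [-> r0 r1]].
apply: reach_seq; first exact: (@read_loop_spec R n z z z r y z q s key).
move=> _ [f [A [r' [P [-> f1 A_L [{}r0 {}r1] PE]]]]].
set L := [seq x <- iota 0 n | 0 < key x] in f1 A_L r1.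
set N := size L in f1 A_L r1.
have Nn : (N <= n)%N by rewrite /N size_filter -{2}(size_iota 0 n) count_size.
have N_log : (N <= 2 ^ (trunc_log 2 n).+1)%N.
  by apply: leq_trans Nn (ltnW _); rewrite trunc_log_ltn.
apply: reach_seq.
  refine (reach_le (@sort_jobs_spec R n r' P z q f A z N _ f1 N_log) _).
  by rewrite leq_add2l leq_add2r leq_mul2l leq_add2l pass_cost_mono ?orbT.
move=> _ [g [A' [B' [-> g1 prm srt]]]]; rewrite A_L in prm.
have A'_lt : all (fun x => x < n)%N (slice A' 0 N).
  rewrite (perm_all _ prm); apply/allP => x; rewrite mem_filter mem_iota.
  by case/and3P.
have [js js_A'] := ord_seq A'_lt.
have Pp (j : 'I_n) : P (nat_of_ord j) = p j by rewrite PE // keyE.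
have psE : [seq P x | x <- slice A' 0 N] = [seq p j | j <- js].
  by rewrite -js_A' -map_comp; apply: eq_map => j /=.
have mem_js j : (j \in js) = (0 < p j).
  rewrite -(mem_map (@ord_inj n)) js_A' (perm_mem prm) mem_filter mem_iota /=.
  by rewrite keyE ltn_ord andbT.
have uniq_js : uniq js.
  by rewrite -(map_inj_uniq (@ord_inj n)) js_A' (perm_uniq prm) filter_uniq ?iota_uniq.
have sorted_js : sorted <=%R [seq p j | j <- js] by rewrite -psE sorted_map.
apply: reach_seq.
  apply: (@reach_run _ _ _ (fun st => exists f r,
    st = conc n (Layout f A' B' r P z q) /\
    [/\ f 1%N = N, f 3%N = 0%N & f 8%N = 0%N] /\
    [/\ r 0%N = s, r 1%N = N%:R * s, r 2%N = 0, r 3%N = 0 & r 4%N = 0])) => //.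
  rewrite /scan_start /reset !run_seq; do 5!rewrite ?runE ?evalE //=.
  by do 2!eexists; split; first by reflexivity.
move=> _ [f' [u [-> [[f1' f3' f8'] [u0 u1 u2 u3 u4]]]]].
apply: reach_seq.
  refine (reach_le (@scan_loop_spec R n f' A' B' u P z q s N s0 f1' f3' f8' u0 u1 u2 u3 u4) _).
  by rewrite leq_add2r leq_mul2r Nn orbT.
rewrite psE => _ [h [v [-> h1 best v0]]].
apply: reach_seq.
  apply: (@reach_run _ _ _ (fun st => exists f r,
    st = conc n (Layout f A' B' r P z q) /\
    [/\ f 1%N = N, f 8%N = h 8%N, f 3%N = 0%N, f 9%N = 0%N & f 10%N = 0%N] /\
    [/\ r 0%N = s, r 5%N = 0 & r 6%N = 0])) => //.
  rewrite /write_start /reset !run_seq; do 5!rewrite ?runE ?evalE //=.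
  by do 2!eexists; split; first by reflexivity.
move=> _ [h' [v' [-> [[h1' h8' h3' h9' h10'] [v0' v5' v6']]]]].
apply: reach_seq.
  refine (reach_le
    (@write_loop_spec R n h' A' B' v' P z q s N _ p js js_A' Pp Nn h1' h8' h3' h9' h10' v0' v5' v6') _).
  by rewrite leq_add2r leq_mul2r Nn orbT.
move=> _ [w [w' [o [q' [-> w9 dec]]]]].
apply: reach_run => //; exists (build s p (h 8%N) 0 0 false js).
split; last exact: build_optimal.
rewrite /output -/(map (@encode R n) _) -dec.
rewrite [run _ _]/run /= !evalE //=; apply/eq_in_map => i.
rewrite mem_iota add0n => /andP[_ lt_i]; rewrite /conc /=.
(* There are at most [2 * n] parts, so all their cells lie in the output areas. *)
have /and3P[-> -> ->] : [&& 3 * i <= 6 * n, 3 * i + 1 <= 6 * n & 3 * i + 2 <= 6 * n]%N.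
  by apply/and3P; split; lia.
have /andP[-> ->] : (2 * i + 1 <= 4 * n)%N && (2 * i + 2 <= 4 * n)%N.
  by apply/andP; split; lia.
by rewrite !addn_eq0 !andbF.
Qed.

Theorem theorem1 (R : realFieldType) :
  exists (A : cmd) (T : nat -> nat),
    (exists c N : nat,
       forall n : nat, (N <= n)%N -> (T n <= c * (n * trunc_log 2 n))%N) /\
    forall (n : nat) (s : R) (p : 'I_n -> R),
      0 < s -> (forall j : 'I_n, 0 <= p j) ->
      exists (t : nat) (st : state R) (S : schedule R 2 n),
        [/\ exec A (input s p) t st,
            (t <= T n)%N,
            output st S
          & optimal s p S].
Proof.
exists scheduler, scheduler_time; split.
  by have [c le_c] := scheduler_time_linearithmic; exists c, 2.
move=> n s p s0 p0; have [t [st [ex le_t [S [out opt]]]]] := scheduler_spec s0 p0.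
by exists t, st, S.
Qed.
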